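(* Let $C^*$ be a perfect $\mathbb{F}_2[A_4]$-cochain complex such that its total homology is four-dimensional over $\mathbb{F}_2$ with basis elements in degrees $0\le m\le n\le t$. Then $C^*$ is homotopy equivalent to a finite, free $\mathbb{F}_2[A_4]$-cochain complex if and only if $m$ or $n$ is odd and $H^*(C^* )$ is a trivial $C_3$-representation.
   Context: $A_4=(\mathbb{Z}/2\times\mathbb{Z}/2)\rtimes C_3$ is the alternating group; the $C_3$-action on $H^*(C^* )$ is the restriction of the $A_4$-action to $C_3\subset A_4$. A perfect cochain complex is a bounded complex of finitely generated projective modules, and a finite, free cochain complex is a bounded complex of finitely generated free modules. Degrees of basis elements are counted with multiplicity. *)

(* Defs.v *)
From mathcomp Require Import all_boot all_order all_algebra.
From mathcomp Require Import all_fingroup all_solvable all_character.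

Set Implicit Arguments.
Unset Strict Implicit.
Unset Printing Implicit Defensive.

Import GRing.Theory.
Local Open Scope ring_scope.

(* A finitely generated F[G]-module, for a field F and a finite group G, is a *)
(* finite-dimensional representation of G over F.  Vectors are rows, so these *)
(* are right modules; they correspond to left modules through g |-> g^-1.     *)

Section Modules.

Variables (F : fieldType) (gT : finGroupType) (G : {group gT}).
Implicit Types M N : representation F G.

Definition free_module M : Prop :=
  exists k : nat,
    mx_rsim M (muln_grepr (Representation (regular_repr F G)) k).

Definition projective_module M : Prop :=
  exists N, free_module (dadd_grepr M N).

Definition module_hom M N (f : 'M[F]_(rdegree M, rdegree N)) : Prop :=
  forall x, x \in G -> M x *m f = f *m N x.

Definition trivial_module n (rG : mx_representation F G n) : Prop :=
  forall x, x \in G -> rG x = 1%:M.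

End Modules.

Section Complexes.

Variables (F : fieldType) (gT : finGroupType) (G : {group gT}).

(* The differential is given for every pair (i, j) of degrees and vanishes    *)
(* unless j = i + 1; this avoids transports along (i - 1) + 1 = i.            *)
Record cochain_complex := CochainComplex {
  cobj :> int -> representation F G;
  cdiff : forall i j : int, 'M[F]_(rdegree (cobj i), rdegree (cobj j));
  cdiff_hom : forall i j, module_hom (cdiff i j);
  cdiff_shape : forall i j, j != i + 1 -> cdiff i j = 0;
  cdiff_sq0 : forall i j k, cdiff i j *m cdiff j k = 0
}.

Implicit Types C D : cochain_complex.

Definition bounded C : Prop :=
  exists b : nat, forall i : int, (b < `|i|)%N -> rdegree (C i) = 0%N.

Definition perfect C : Prop :=
  bounded C /\ forall i, projective_module (C i).

Definition finite_free C : Prop :=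
  bounded C /\ forall i, free_module (C i).

Definition cocycles C (i : int) : 'M[F]_(rdegree (C i)) :=
  kermx (cdiff C i (i + 1)).

Definition coboundaries C (i : int) : 'M[F]_(rdegree (C i)) :=
  <<cdiff C (i - 1) i>>%MS.

Lemma cocycles_module C i : mxmodule (C i) (cocycles C i).
Proof.
apply/mxmoduleP=> x Gx; apply/sub_kermxP.
by rewrite -mulmxA cdiff_hom // mulmxA mulmx_ker mul0mx.
Qed.

Lemma coboundaries_module C i : mxmodule (C i) (coboundaries C i).
Proof.
rewrite (eqmx_module _ (genmxE _)); apply/mxmoduleP=> x Gx.
by rewrite -cdiff_hom // submxMl.
Qed.

(* [section_repr modB modZ] is the representation on (Z + B) / B, and here    *)
(* the coboundaries B are contained in the cocycles Z.                        *)
Definition cohomology C (i : int) : representation F G :=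
  Representation
    (section_repr (coboundaries_module C i) (cocycles_module C i)).

Definition graded_map C D : Type :=
  forall i : int, 'M[F]_(rdegree (C i), rdegree (D i)).

Definition cochain_map C D (f : graded_map C D) : Prop :=
  (forall i, module_hom (f i)) /\
  (forall i j, cdiff C i j *m f j = f i *m cdiff D i j).

(* Only the components h i (i - 1) of h are used. *)
Definition homotopic C D (f g : graded_map C D) : Prop :=
  exists2 h : forall i j : int, 'M[F]_(rdegree (C i), rdegree (D j)),
    forall i j, module_hom (h i j) &
    forall i, f i - g i = h i (i - 1) *m cdiff D (i - 1) i
                          + cdiff C i (i + 1) *m h (i + 1) i.

Definition homotopy_equivalent C D : Prop :=
  exists (f : graded_map C D) (g : graded_map D C),
    [/\ cochain_map f, cochain_map g,
        homotopic (fun i => f i *m g i : 'M_(rdegree (C i))) (fun i => 1%:M)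
      & homotopic (fun i => g i *m f i : 'M_(rdegree (D i))) (fun i => 1%:M)].

End Complexes.

(* Main.v *)
Require Import Defs.
From mathcomp Require Import all_boot all_order all_algebra.
From mathcomp Require Import all_fingroup all_solvable all_character.
From mathcomp Require Import zify.

Set Implicit Arguments.
Unset Strict Implicit.
Unset Printing Implicit Defensive.
Import Order.TTheory GRing.Theory Num.Theory.

(** Let [k] be the field with two elements, [V] the Klein four-group in [A4], and
    [c] a generator of [C3].  The simple [k A4]-modules are the trivial module
    [k] and the plane [W] on which [V] acts trivially and [c] has no non-zero
    fixed vector.  Restricted to [C3], the projective covers of [k] and [W] are
    [2 k + W] and [2 k + 3 W], and [k A4] is their sum.  Hence the function

      [psi M = 3 dim M^C3 - dim M],

    which is twice the difference of the multiplicities of [k] and [W], is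
    additive on exact sequences, takes the values 2 and -2 on the two
    indecomposable projectives, and a projective module is free if and only if
    [psi] vanishes on it ([vfree_psi0_free]).

    If the alternating sum of [psi (C i)] vanishes, then adding contractible
    complexes with projective terms makes [C] free in every degree
    ([free_replacement]).  Conversely the alternating sum can be computed on the
    cohomology ([euler_psi]), which is invariant under homotopy equivalence
    ([psi_cohomology_homotopy]), so it vanishes if [C] is equivalent to a free
    complex.

    Let [w i] be the multiplicity of [W] in the cohomology of degree [i].  The
    alternating sum of [psi] vanishes when the alternating sum of the dimensions
    is three times that of the [w i].  The former is divisible by four, because
    projective modules have dimension divisible by four ([vfree_projective]), and
    the latter is at most six in absolute value; so both vanish
    ([simple_degrees]).  The sum [1 + (-1)^m + (-1)^n + (-1)^t], being divisible
    by four, vanishes exactly when [m] or [n] is odd.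

    It remains to exclude that [W] occurs without destroying the Euler
    characteristic, that is, once in degree 0 and once in an odd degree [n].  Such
    a complex would identify the [n]-th cosyzygy of a trivial [k V]-plane with its
    first syzygy, up to free summands, while [V] has no periodic cohomology.  The
    elementary reason used here is a numerical function of [k V]-modules that
    vanishes on free modules, does not decrease under cosyzygies, is positive on
    trivial modules and negative on their syzygies ([phi_image],
    [no_two_simples]).

    Freeness over [V] is handled by dimensions only: a [k V]-module [M] with norm
    element [N] is free if and only if [dim M = 4 dim (M N)] ([rank_le_frank]).
    *)

(** * Ranks attached to modules over the Klein four-group *)

Section KleinRanks.

Local Open Scope ring_scope.

Variables (F : fieldType) (n : nat) (X Y : 'M[F]_n).
Hypotheses (XX : X *m X = 0) (YY : Y *m Y = 0) (XY : X *m Y = Y *m X).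

(** [X] and [Y] stand for [1 + a] and [1 + b], where [a] and [b] generate the
    Klein four-group [V].  On a [V]-submodule [U], [frank] is then the dimension
    of the [V]-invariants, [nrank] is the rank of the norm element [X Y], which
    is the number of free summands of [U], and [krad] is the radical. *)
Definition kfix : 'M[F]_n := (kermx X :&: kermx Y)%MS.
Definition frank k (U : 'M[F]_(k, n)) := \rank (U :&: kfix)%MS.
Definition nrank k (U : 'M[F]_(k, n)) := \rank (U *m (X *m Y)).
Definition krad k (U : 'M[F]_(k, n)) := (U *m X + U *m Y)%MS.

Variables (k : nat) (U : 'M[F]_(k, n)).
Hypotheses (UX : (U *m X <= U)%MS) (UY : (U *m Y <= U)%MS).

Let K := (U :&: kermx X)%MS.

Let frankE : \rank (K :&: kermx Y) = frank U.
Proof. by rewrite /K /frank /kfix capmxA. Qed.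

Let splitU : \rank U = (\rank (U *m X) + \rank K)%N.
Proof. by rewrite mxrank_mul_ker. Qed.

Let splitUX : \rank (U *m X) = (nrank U + \rank ((U *m X) :&: kermx Y)%MS)%N.
Proof. by rewrite /nrank mulmxA mxrank_mul_ker. Qed.

Let splitK : \rank K = (\rank (K *m Y) + frank U)%N.
Proof. by rewrite -frankE mxrank_mul_ker. Qed.

Let UXK : (U *m X <= K)%MS.
Proof. by rewrite sub_capmx UX; apply/sub_kermxP; rewrite -mulmxA XX mulmx0. Qed.

Let KYK : (K *m Y <= K :&: kermx Y)%MS.
Proof.
rewrite !sub_capmx (submx_trans _ UY) ?submxMr ?capmxSl //=.
apply/andP; split; apply/sub_kermxP; last by rewrite -mulmxA YY mulmx0.
have /sub_kermxP KX : (K <= kermx X)%MS by apply: capmxSr.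
by rewrite -mulmxA -XY mulmxA KX mul0mx.
Qed.

Let nrank_le_KY : (nrank U <= \rank (K *m Y))%N.
Proof. by rewrite mxrankS // mulmxA submxMr. Qed.

Let nrank_le_UX : (2 * nrank U <= \rank (U *m X))%N.
Proof.
rewrite splitUX mul2n -addnn leq_add2l mxrankS // sub_capmx.
rewrite {1}XY mulmxA submxMr //=.
by apply/sub_kermxP; rewrite -!mulmxA YY !mulmx0.
Qed.

Lemma nrank_le_frank : (nrank U <= frank U)%N.
Proof. by rewrite (leq_trans nrank_le_KY) // -frankE mxrankS. Qed.

(** With [rank_ge_nrank] this gives [3 r + s <= d <= 3 s + r] for the rank [r]
    of the norm, the dimension [s] of the invariants and the dimension [d].
    Hence [d = 4 r], [d = 4 s] and [r = s] are equivalent, and freeness over [V]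
    can be tested on dimensions alone. *)
Lemma rank_le_frank : (\rank U <= 3 * frank U + nrank U)%N.
Proof.
have h1 : (\rank (K *m Y) <= frank U)%N by rewrite -frankE mxrankS.
have h2 : (\rank ((U *m X) :&: kermx Y)%MS <= frank U)%N.
  by rewrite -frankE mxrankS // capmxS.
by move: splitU splitUX splitK; lia.
Qed.

Lemma rank_ge_nrank : (3 * nrank U + frank U <= \rank U)%N.
Proof. by move: splitU splitK nrank_le_KY nrank_le_UX; lia. Qed.

Let L := (krad U :&: kermx X)%MS.

Let rad_sub : (krad U <= U)%MS.
Proof. by rewrite addsmx_sub UX UY. Qed.

Let split_rad : \rank (krad U) = (nrank U + \rank L)%N.
Proof.
rewrite -(mxrank_mul_ker (krad U) X); congr (_ + _)%N.
rewrite addsmxMr -[U *m X *m X]mulmxA XX mulmx0 adds0mx.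
by rewrite -mulmxA -XY.
Qed.

Lemma rank_krad_ge : (3 * nrank U <= \rank (krad U))%N.
Proof.
have : (\rank (U *m X) <= \rank L)%N.
  rewrite mxrankS // sub_capmx addsmxSl.
  by apply/sub_kermxP; rewrite -mulmxA XX mulmx0.
by move: split_rad nrank_le_UX; lia.
Qed.

(** Killing [X] and then [Y] maps the radical of [U] onto a subspace of two
    copies of the image of the norm, and what is left over is invariant. *)
Lemma rank_krad_le : (\rank (krad U) <= frank U + 2 * nrank U)%N.
Proof.
have h1 : (\rank (L *m Y) <= nrank U)%N.
  rewrite /nrank mxrankS // (submx_trans (submxMr _ (capmxSl _ _))) //.
  by rewrite addsmxMr -[U *m Y *m Y]mulmxA YY mulmx0 addsmx0 mulmxA.
have h2 : (\rank (L :&: kermx Y)%MS <= frank U)%N.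
  by rewrite -frankE mxrankS // capmxS // capmxS.
by move: split_rad (mxrank_mul_ker L Y); lia.
Qed.

Lemma krad_sub_ker : (krad U <= kermx (X *m Y))%MS.
Proof.
rewrite addsmx_sub; apply/andP; split; apply/sub_kermxP.
  by rewrite -mulmxA [X *m (_ *m _)]mulmxA XX mul0mx mulmx0.
by rewrite -mulmxA XY [Y *m (_ *m _)]mulmxA YY mul0mx mulmx0.
Qed.

(** If [V] acts trivially on [Z / U], then [X] maps [Z] into the kernel of [X]
    on [U], whose dimension is at most [2 s] for [s] the dimension of the
    invariants of [U], and [Y] maps the kernel of [X] on [Z] into these
    invariants. *)
Lemma rank_trivial_ext l (Z : 'M[F]_(l, n)) :
    (Z *m X <= U)%MS -> (Z *m Y <= U)%MS ->
  (\rank Z <= 3 * frank U + frank Z)%N.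
Proof.
move=> ZX ZY.
have ZXK : (Z *m X <= K)%MS.
  by rewrite sub_capmx ZX; apply/sub_kermxP; rewrite -mulmxA XX mulmx0.
have h1 : (\rank ((Z :&: kermx X)%MS *m Y) <= frank U)%N.
  rewrite -frankE mxrankS // !sub_capmx.
  rewrite (submx_trans _ ZY) ?submxMr ?capmxSl //=.
  apply/andP; split; apply/sub_kermxP; last by rewrite -mulmxA YY mulmx0.
  have /sub_kermxP ZKX : (Z :&: kermx X <= kermx X)%MS by apply: capmxSr.
  by rewrite -mulmxA -XY mulmxA ZKX mul0mx.
have h2 : (\rank (K *m Y) <= frank U)%N by rewrite -frankE mxrankS.
have := mxrankS ZXK; move: (mxrank_mul_ker Z X).
move: (mxrank_mul_ker (Z :&: kermx X)%MS Y) splitK.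
by rewrite -capmxA -[(kermx X :&: _)%MS]/kfix -/(frank Z); lia.
Qed.

(** If [V] acts trivially on [Z / U], then [U] contains the radical of [Z], which
    the norm kills. *)
Lemma krad_nrank_sub l (Z : 'M[F]_(l, n)) :
    (Z *m X <= U)%MS -> (Z *m Y <= U)%MS ->
  (nrank U + \rank (krad Z) <= \rank U)%N.
Proof.
move=> ZX ZY; rewrite -(mxrank_mul_ker U (X *m Y)) leq_add2l.
rewrite mxrankS // sub_capmx addsmx_sub ZX ZY /= addsmx_sub.
apply/andP; split; apply/sub_kermxP.
  by rewrite -mulmxA [X *m (_ *m _)]mulmxA XX mul0mx mulmx0.
by rewrite -mulmxA XY [Y *m (_ *m _)]mulmxA YY mul0mx mulmx0.
Qed.

End KleinRanks.

(** * Operators of order three over the field with two elements *)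

Section OrderThree.

Local Open Scope ring_scope.

Lemma addmm2 m n (A : 'M['F_2]_(m, n)) : A + A = 0.
Proof. by apply/matrixP=> i j; rewrite !mxE addrr_pchar2 // pchar_Fp. Qed.

Lemma oppmx2 m n (A : 'M['F_2]_(m, n)) : - A = A.
Proof. by apply/eqP; rewrite eq_sym -addr_eq0 addmm2. Qed.

Lemma F2_case (x : 'F_2) : x = 0 \/ x = 1.
Proof.
by case: x => [[|[|m]] lt_m] //; [left | right]; apply/eqP.
Qed.

Lemma addKmx2 m n (A B : 'M['F_2]_(m, n)) : A + (A + B) = B.
Proof. by rewrite addrA addmm2 add0r. Qed.

Variables (n : nat) (c : 'M['F_2]_n).
Hypothesis c3 : c *m c *m c = 1%:M.

(** Since 3 = 1 in the field, the norm of [c] is the projection onto the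
    invariants of [c]. *)
Let e : 'M_n := 1%:M + c + c *m c.

Lemma mulc_avg : c *m e = e.
Proof. by rewrite /e !mulmxDr mulmx1 mulmxA c3 addrC addrA. Qed.

Lemma mul_avgc : e *m c = e.
Proof. by rewrite /e !mulmxDl mul1mx c3 addrC addrA. Qed.

Lemma avg_idem : e *m e = e.
Proof.
by rewrite {1}/e !mulmxDl mul1mx -mulmxA !mulc_avg -addrA addmm2 addr0.
Qed.

Section Stable.

Variables (k : nat) (U : 'M['F_2]_(k, n)).
Hypothesis Uc : (U *m c <= U)%MS.

Lemma stable_avg : (U *m e <= U)%MS.
Proof.
have Ucc : (U *m (c *m c) <= U)%MS.
  by rewrite mulmxA (submx_trans _ Uc) ?submxMr.
by rewrite !mulmxDr mulmx1 !addmx_sub.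
Qed.

Lemma stable_compl : (U *m (1%:M - e) <= U)%MS.
Proof. by rewrite mulmxBr mulmx1 addmx_sub ?eqmx_opp ?stable_avg. Qed.

Lemma stable_split : (U :=: U *m e + U *m (1%:M - e))%MS.
Proof.
apply/eqmxP; rewrite addsmx_sub stable_avg stable_compl /= andbT.
have {1}-> : U = U *m e + U *m (1%:M - e).
  by rewrite -mulmxDr addrC subrK mulmx1.
exact: addmx_sub_adds.
Qed.

Lemma rank_avg_compl : \rank U = (\rank (U *m e) + \rank (U *m (1%:M - e)))%N.
Proof.
rewrite -(mxrank_mul_ker U e); congr (_ + _)%N.
apply/eqP; rewrite eqn_leq !mxrankS //.
  rewrite sub_capmx stable_compl; apply/sub_kermxP.
  by rewrite -mulmxA mulmxBl mul1mx avg_idem subrr mulmx0.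
have /sub_kermxP Ke : (U :&: kermx e <= kermx e)%MS by apply: capmxSr.
have {1}-> : (U :&: kermx e)%MS = (U :&: kermx e)%MS *m (1%:M - e).
  by rewrite mulmxBr mulmx1 Ke subr0.
by rewrite submxMr ?capmxSl.
Qed.

End Stable.

Section Pairs.

Variables (k : nat) (T : 'M['F_2]_(k, n)).
Hypotheses (Tc : (T *m c <= T)%MS) (Te : T *m e = 0).

Let wcc m (w : 'M_(m, n)) : (w <= T)%MS -> w *m c *m c = w + w *m c.
Proof.
case/submxP=> D ->; apply/eqP; rewrite eq_sym -subr_eq0 oppmx2.
rewrite -[_ *m c *m c]mulmxA -[X in X + _ + _]mulmx1 -!mulmxDr -/e.
by rewrite -mulmxA Te mulmx0.
Qed.

(** If [1 + c + c^2] kills [T], then [T] is a direct sum of planes [<v, v c>].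
    The induction adds a plane at a time: for [v] in [T] outside a stable
    subspace [L], no non-zero combination of [v] and [v c] lies in [L], because
    each of [v], [v c] and [v + v c = v c^2] generates the same plane under
    [c]. *)
Lemma stable_pairs_ext d m (w : 'M['F_2]_(m, n)) :
    (w <= T)%MS -> row_free (col_mx w (w *m c)) -> (\rank T <= 2 * m + d)%N ->
  exists m' (w' : 'M['F_2]_(m', n)),
    (T :=: col_mx w' (w' *m c))%MS /\ \rank T = (2 * m')%N.
Proof.
elim: d m w => [|d IHd] m w wT fw leT.
  exists m, w.
  have LT : (col_mx w (w *m c) <= T)%MS.
    by rewrite col_mx_sub wT (submx_trans _ Tc) ?submxMr.
  move: fw; rewrite -row_leq_rank => fw.
  split; last by apply/eqP; move: (mxrankS LT) fw leT; lia.
  apply/eqmxP; rewrite LT andbT -(mxrank_leqif_sup LT).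
  by apply/eqP; move: (mxrankS LT) fw leT; lia.
set L := col_mx w (w *m c) in fw.
have [TL|/row_subPn[i]] := boolP (T <= L)%MS.
  apply: (IHd m w) => //; move: (mxrankS TL) (rank_leq_row L); lia.
set v := row i T => vL.
have vT : (v <= T)%MS by apply: row_sub.
have Lc : (L *m c <= L)%MS.
  rewrite mul_col_mx col_mx_sub wcc // -!addsmxE addsmxSr /=.
  exact: addmx_sub_adds.
have vcL : ~~ (v *m c <= L)%MS.
  apply: contra vL => vcL; rewrite -[v]mulmx1 -c3 !mulmxA.
  by do 2!(rewrite (submx_trans _ Lc) // submxMr //).
have vcLv : ~~ (v *m c <= L + v)%MS.
  apply/negP=> /sub_addsmxP[[D1 D2] /= vcE].
  have [D20|D21] := F2_case (D2 0 0).
    case/negP: vcL; rewrite vcE [D2]mx11_scalar D20 mul_scalar_mx scale0r addr0.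
    exact: submxMl.
  rewrite [D2]mx11_scalar D21 mul_scalar_mx scale1r in vcE.
  have vvcL : ((v + v *m c)%R <= L)%MS.
    by rewrite vcE addrC -addrA addmm2 addr0 submxMl.
  case/negP: vL; rewrite -wcc // in vvcL.
  by rewrite -[v]mulmx1 -c3 !mulmxA (submx_trans _ Lc) // submxMr.
apply: (IHd (1 + m)%N (col_mx v w)).
- by rewrite col_mx_sub vT.
- rewrite -row_leq_rank mul_col_mx.
  have lt1 : (\rank L < \rank (L + v)%MS)%N.
    rewrite rank_ltmx // ltmxE addsmxSl /=; apply: contra vL.
    exact: submx_trans (addsmxSr _ _).
  have lt2 : (\rank (L + v)%MS < \rank (L + v + v *m c)%MS)%N.
    rewrite rank_ltmx // ltmxE addsmxSl /=; apply: contra vcLv.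
    exact: submx_trans (addsmxSr _ _).
  suff le3 : (L + v + v *m c <= col_mx (col_mx v w) (col_mx (v *m c) (w *m c)))%MS.
    by move: fw lt1 lt2 (mxrankS le3); rewrite -row_leq_rank; lia.
  set M := col_mx (col_mx v w) _.
  have : (M <= M)%MS by [].
  rewrite {1}/M !col_mx_sub => /andP[/andP[h1 h2] /andP[h3 h4]].
  by rewrite !addsmx_sub h1 h3 col_mx_sub h2 h4.
- lia.
Qed.

Lemma stable_pairs :
  exists m (w : 'M['F_2]_(m, n)),
    (T :=: col_mx w (w *m c))%MS /\ \rank T = (2 * m)%N.
Proof.
apply: (@stable_pairs_ext (\rank T) 0 0); rewrite ?sub0mx //.
by rewrite -row_leq_rank.
Qed.

End Pairs.

(** A module over the group of order three is a sum of trivial lines and of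
    planes without invariants. *)
Lemma rank_compl_even k (U : 'M['F_2]_(k, n)) :
  (U *m c <= U)%MS -> exists m, \rank (U *m (1%:M - e)) = (2 * m)%N.
Proof.
move=> Uc; have [||m [w [_ ->]]] := @stable_pairs _ (U *m (1%:M - e)).
- have ce : (1%:M - e) *m c = c *m (1%:M - e).
    by rewrite mulmxBl mulmxBr mul_avgc mulc_avg mul1mx mulmx1.
  by rewrite -mulmxA ce mulmxA submxMr.
- by rewrite -mulmxA mulmxBl mul1mx avg_idem subrr mulmx0.
by exists m.
Qed.

(** When the invariants fill a third of [U], there are as many trivial lines as
    planes in [U].  Adding the generator of a line to the generator of a plane
    gives a generator of a free module, so [U] is free. *)
Lemma stable_generators k (U : 'M['F_2]_(k, n)) :
    (U *m c <= U)%MS -> (3 * \rank (U *m e) = \rank U)%N ->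
  exists m (u : 'M['F_2]_(m, n)),
    (u + u *m c + u *m c *m c :=: U)%MS /\ \rank U = (3 * m)%N.
Proof.
move=> Uc rU; have [||m [w [eqw rw]]] := @stable_pairs _ (U *m (1%:M - e)).
- have ce : (1%:M - e) *m c = c *m (1%:M - e).
    by rewrite mulmxBl mulmxBr mul_avgc mulc_avg mul1mx mulmx1.
  by rewrite -mulmxA ce mulmxA submxMr.
- by rewrite -mulmxA mulmxBl mul1mx avg_idem subrr mulmx0.
have [u0 [u0U rm]] : exists u0 : 'M['F_2]_(m, n), (u0 :=: U *m e)%MS
     /\ \rank (U *m e) = m.
  have rm : \rank (U *m e) = m by move: (rank_avg_compl Uc); lia.
  by rewrite -rm; exists (row_base (U *m e)); split=> //; apply: eq_row_base.
exists m, (u0 + w); split; last by rewrite -rU rm.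
have wU : (w <= U *m (1%:M - e))%MS.
  by rewrite eqw -addsmxE addsmxSl.
have wcU : (w *m c <= U *m (1%:M - e))%MS.
  by rewrite eqw -addsmxE addsmxSr.
have we : w *m e = 0.
  case/submxP: wU => D ->.
  by rewrite -!mulmxA mulmxBl mul1mx avg_idem subrr !mulmx0.
have u0e : u0 *m e = u0.
  have /submxP[D ->] : (u0 <= U *m e)%MS by rewrite u0U.
  by rewrite -!mulmxA avg_idem.
have u0c : u0 *m c = u0 by rewrite -u0e -mulmxA mul_avgc.
set u := u0 + w.
have uU : (u <= U)%MS.
  rewrite addmx_sub ?u0U ?stable_avg //.
  exact: submx_trans wU (stable_compl Uc).
have ucU : (u *m c <= U)%MS by rewrite (submx_trans _ Uc) ?submxMr.
apply/eqmxP; rewrite !addsmx_sub uU ucU (submx_trans _ Uc) ?submxMr //=.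
set S := (u + _ + _)%MS.
have : (S <= S)%MS by [].
rewrite {1}/S !addsmx_sub => /andP[/andP[h1 h2] h3].
have u0S : (u0 <= S)%MS.
  have -> : u0 = u *m e by rewrite mulmxDl we addr0 u0e.
  by rewrite !mulmxDr mulmx1 mulmxA; do 2!apply: addmx_sub => //.
rewrite (stable_split Uc) addsmx_sub -u0U u0S eqw col_mx_sub.
have wE : w = u0 + u by rewrite /u addKmx2.
have wcE : w *m c = u0 + u *m c by rewrite /u mulmxDl u0c addKmx2.
by rewrite wcE {1}wE /=; apply/andP; split; apply: addmx_sub.
Qed.

End OrderThree.

(** * Generators of the alternating group of degree four *)

Section KleinElements.

Let seq_fun (s : seq nat) k := nth 0 s k.
Let swap := seq_fun [:: 1; 0; 3; 2].

(** [f] is the permutation with values [i, j, k, l], and [conj] is the conjugate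
    of [swap] by [f] when [f] has order three, since the inverse of [f] is then
    its square. *)
Let klein_check (i j k l : nat) : bool :=
  let f := seq_fun [:: i; j; k; l] in
  let pts := iota 0 4 in
  let conj x := f (swap (f (f x))) in
  all (fun x => f (f (f x)) == x) pts ==> ~~ all (fun x => f x == x) pts ==>
  [&& all (fun x => conj (swap x) == swap (conj x)) pts,
      all (fun x => f (conj x) == conj (swap (f x))) pts,
      conj 0 != 0 & conj (swap 0) != 0].

Let klein_checked :
  all (fun i => all (fun j => all (fun k => all (fun l => klein_check i j k l)
    (iota 0 4)) (iota 0 4)) (iota 0 4)) (iota 0 4).
Proof. by vm_compute. Qed.

Let all_ord4 (P : pred nat) :
  all P (iota 0 4) = [forall i : 'I_4, P i].
Proof.
apply/allP/forallP => [h i|h i]; first by apply: h; rewrite mem_iota /=.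
by rewrite mem_iota => /andP[_ lt_i]; apply: (h (Ordinal lt_i)).
Qed.

Local Open Scope group_scope.

(** A double transposition and its conjugates by an element of order three are
    the three involutions of the Klein four-group.  This is checked on the values
    of the element of order three, of which there are only finitely many. *)
Lemma klein_elements (C3 : {group {perm 'I_4}}) :
    C3 \subset 'Alt_('I_4) -> #|C3| = 3 ->
  exists a b c : {perm 'I_4},
    [/\ [/\ a \in 'Alt_('I_4), b \in 'Alt_('I_4) & c \in 'Alt_('I_4)],
        C3 :=: <[c]> /\ #[c] = 3,
        [/\ a * a = 1, b * b = 1 & a * b = b * a],
        a * c = c * b /\ b * c = c * (a * b)
      & [/\ a ord0 != ord0, b ord0 != ord0 & (a * b) ord0 != ord0]].
Proof.
move=> sC3 oC3; have /cyclicP[c C3c] : cyclic C3.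
  by apply: prime_cyclic; rewrite oC3.
have oc : #[c] = 3 by rewrite /order -C3c.
have c3 : c * c * c = 1 by have := expg_order c; rewrite oc !expgS expg0 mulg1 mulgA.
have cV : c^-1 = c * c by apply/eqP; rewrite eq_invg_mul mulgA c3.
have cA : c \in 'Alt_('I_4) by rewrite (subsetP sC3) // C3c cycle_id.
pose f := seq_fun [:: c (inord 0) : nat; c (inord 1) : nat;
                      c (inord 2) : nat; c (inord 3) : nat].
have cf (i : 'I_4) : f i = c i.
  case: i => [[|[|[|[|i]]]] lt_i] //; rewrite /f /seq_fun /=;
    congr (nat_of_ord (c _)); apply/val_inj; rewrite /= ?inordK //.
pose a : {perm 'I_4} := tperm (inord 0) (inord 1) * tperm (inord 2) (inord 3).
have oE k (lt_k : k < 4) : Ordinal lt_k = inord k.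
  by apply/val_inj; rewrite /= inordK.
have oD k l : k < 4 -> l < 4 -> k != l -> inord k != inord l :> 'I_4.
  by move=> ltk ltl; rewrite -val_eqE /= !inordK.
have af (i : 'I_4) : swap i = a i.
  rewrite permM; case: i => [[|[|[|[|i]]]] lt_i] //; rewrite oE.
  - by rewrite tpermL tpermD ?oD // !inordK.
  - by rewrite tpermR tpermD ?oD // !inordK.
  - by rewrite [X in tperm _ _ X]tpermD ?oD // tpermL !inordK.
  - by rewrite [X in tperm _ _ X]tpermD ?oD // tpermR !inordK.
have aA : a \in 'Alt_('I_4).
  by rewrite Alt_even odd_permM !odd_tperm -!val_eqE /= !inordK.
pose b := a ^ c.
have bE i : b i = c (a (c (c i))) by rewrite /b conjgE cV !permM.
have bA : b \in 'Alt_('I_4) by rewrite groupJ.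
have a2 : a * a = 1.
  by apply/permP=> i; apply/val_inj; rewrite /= permM perm1 -!af; case: i => [[|[|[|[|i]]]]].
have b2 : b * b = 1 by rewrite -conjMg a2 conj1g.
have ab : a * c = c * b by rewrite /b conjgE !mulgA mulgV mul1g.
clearbody b a.
have f_all (P Q : nat -> nat) :
    (forall i : 'I_4, P i = Q i) -> all (fun x => P x == Q x) (iota 0 4).
  by move=> PQ; rewrite all_ord4; apply/forallP=> i; apply/eqP.
have all_f (P Q : nat -> nat) :
    all (fun x => P x == Q x) (iota 0 4) -> forall i : 'I_4, P i = Q i.
  by rewrite all_ord4 => /forallP PQ i; apply/eqP.
have : klein_check (c (inord 0)) (c (inord 1)) (c (inord 2)) (c (inord 3)).
  have m4 (i : 'I_4) : (i : nat) \in iota 0 4 by rewrite mem_iota ltn_ord.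
  have /allP/(_ _ (m4 (c (inord 1)))) := allP klein_checked _ (m4 (c (inord 0))).
  by move=> /allP/(_ _ (m4 (c (inord 2))))/allP/(_ _ (m4 (c (inord 3)))).
rewrite /klein_check -/f => /implyP h.
have {h} /h/implyP h : all (fun x => f (f (f x)) == x) (iota 0 4).
  apply: (f_all (fun x => f (f (f x))) id) => i.
  by rewrite !cf -!permM mulgA c3 perm1.
have {h} /h : ~~ all (fun x => f x == x) (iota 0 4).
  apply/negP=> /(all_f f id) c1.
  have {}c1 : c = 1 by apply/permP=> i; apply/val_inj; rewrite perm1 /= -cf c1.
  by rewrite c1 order1 in oc.
pose g x := f (swap (f (f x))).
case/and4P => /(all_f (fun x => g (swap x)) (fun x => swap (g x))) hab.
move=> /(all_f (fun x => f (g x)) (fun x => g (swap (f x)))) hbc.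
rewrite -[0]/(nat_of_ord (@ord0 3)) => hb hab0.
exists a, b, c; split=> //; split=> //.
- apply/permP=> i; apply/val_inj; rewrite /= !permM !bE.
  by have := hab i; rewrite /g ?(af, cf).
- apply/permP=> i; apply/val_inj; rewrite /= !permM !bE.
  by have := hbc i; rewrite /g ?(af, cf) => ->.
- by rewrite -val_eqE /= -af.
- by apply: contraNneq hb => b0; rewrite ?(af, cf) -bE b0.
- by apply: contraNneq hab0 => ab0; rewrite ?(af, cf) -bE -permM ab0.
Qed.

End KleinElements.

(** * Subgroup sums on the regular representation *)

Section SubgroupSum.

Local Open Scope ring_scope.

Variables (F : fieldType) (gT : finGroupType) (G H : {group gT}).
Hypothesis sHG : H \subset G.

(** The entry of the sum at [(x, y)] is 1 when [x] and [y] lie in the same left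
    coset of [H], and 0 otherwise.  So the sum is [A *m A^T] for the incidence
    matrix [A] between elements and cosets, and [A] has a left inverse given by
    representatives of the cosets. *)
Lemma rank_regular_sum :
  \rank (\sum_(h in H) regular_repr F G h)%R = #|G : H|%g.
Proof.
set S := \sum_(h in H) _; rewrite -card_lcosets.
pose Q := lcosets H G.
pose A : 'M[F]_(#|G|, #|Q|) :=
  \matrix_(i, j) (enum_val i \in (enum_val j : {set gT}))%:R.
pose B : 'M[F]_(#|Q|, #|G|) :=
  \matrix_(j, i) (enum_val i == repr (enum_val j : {set gT}))%:R.
have cosetE (j : 'I_#|Q|) x : x \in (enum_val j : {set gT}) ->
    enum_val j = (x *: H)%g.
  have /lcosetsP[y Gy ->] := enum_valP j.
  by move=> /lcoset_eqP ->.
have QG (j : 'I_#|Q|) x : x \in (enum_val j : {set gT}) -> x \in G.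
  have /lcosetsP[y Gy ->] := enum_valP j.
  case/lcosetP=> h Hh ->; rewrite groupM //; exact: (subsetP sHG).
have QH (i : 'I_#|G|) : (enum_val i *: H)%g \in Q.
  by apply/lcosetsP; exists (enum_val i) => //; apply: enum_valP.
have SE : S = A *m A^T.
  apply/matrixP=> i k; rewrite !mxE summxE.
  have -> : \sum_(h in H) regular_repr F G h i k
      = ((enum_val i)^-1 * enum_val k \in H)%g%:R.
    have gk h : h \in H -> (k == gring_index G (enum_val i * h)%g)
                  = (h == (enum_val i)^-1 * enum_val k)%g.
      move=> Hh; have Gih : (enum_val i * h \in G)%g.
        by rewrite groupM ?enum_valP // (subsetP sHG).
      rewrite -(inj_eq enum_val_inj) gring_indexK // eq_sym.
      by rewrite -[h in RHS](mulKg (enum_val i)) (inj_eq (mulgI _)).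
    have [Hx|nHx] := boolP (_ \in H).
      rewrite (bigD1 _ Hx) big1 => /= [|h /andP[Hh nh]].
        by rewrite !mxE eqxx gk // eqxx addr0.
      by rewrite !mxE eqxx gk // (negPf nh).
    apply: big1 => h Hh; rewrite !mxE eqxx gk //.
    by case: eqP => // hE; case/negP: nHx; rewrite -hE.
  pose j0 := enum_rank_in (QH i) (enum_val i *: H)%g.
  have j0E : enum_val j0 = (enum_val i *: H)%g by rewrite enum_rankK_in.
  rewrite (bigD1 j0) //= big1 => [|j nj]; rewrite !mxE.
    by rewrite j0E lcoset_refl mul1r addr0 mem_lcoset.
  case: (boolP (_ \in _)) => [/cosetE ij|]; last by rewrite mul0r.
  by case/negP: nj; apply/eqP/enum_val_inj; rewrite ij j0E.
have reprQ (j : 'I_#|Q|) : repr (enum_val j : {set gT}) \in (enum_val j : {set gT}).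
  by have /lcosetsP[y Gy ->] := enum_valP j; apply: mem_repr (lcoset_refl _ _).
have BA : B *m A = 1%:M.
  apply/matrixP=> j l; rewrite !mxE.
  have Gr : repr (enum_val j : {set gT}) \in G := QG _ _ (reprQ j).
  rewrite (bigD1 (enum_rank_in Gr (repr (enum_val j : {set gT})))) //=.
  rewrite big1 => [|i ni]; rewrite !mxE.
    rewrite enum_rankK_in // eqxx mul1r addr0; congr (_%:R); congr nat_of_bool.
    apply/idP/eqP=> [/cosetE jl|<-]; last exact: reprQ.
    by apply: enum_val_inj; rewrite jl; apply: cosetE (reprQ j).
  case: eqP => [iE|]; last by rewrite mul0r.
  by case/negP: ni; apply/eqP/enum_val_inj; rewrite enum_rankK_in.
apply/eqP; rewrite eqn_leq SE mulmx_max_rank /=.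
apply: (@mulmx1_min_rank _ _ _ _ _ B B^T).
by rewrite mulmxA BA mul1mx -trmx_mul BA trmx1.
Qed.

End SubgroupSum.

(** Averaging a section [s0] of [N] over the group generated by [C]. *)
Lemma equivariant_section (R : pzRingType) (C N s0 : R) :
    (forall x : R, x + x = 0)%R -> (C * C * C = 1)%R -> (N * C = C * N)%R ->
    (N * s0 * N = N)%R ->
  exists2 s : R, (s * C = C * s)%R & (N * s * N = N)%R.
Proof.
move=> R2 CCC NC NsN.
have CCCr (x : R) : (C * (C * (C * x)) = x)%R by rewrite !mulrA CCC mul1r.
have key x y : (N * x = x * N -> N * y = y * N ->
    N * (x * s0 * y) * N = x * y * N)%R.
  move=> Nx Ny; have -> : (x * y * N = x * N * y)%R by rewrite -mulrA -Ny mulrA.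
  by rewrite -[in RHS]NsN !mulrA Nx -!mulrA Ny.
have NCC : (N * (C * C) = C * C * N)%R by rewrite mulrA NC -mulrA NC mulrA.
exists (s0 + C * C * s0 * C + C * s0 * C * C)%R.
  rewrite !mulrDl !mulrDr -!mulrA CCCr [(C * (C * C))%R]mulrA CCC mulr1.
  by rewrite addrC addrA.
rewrite !mulrDr !mulrDl NsN key // -[(C * s0 * C * C)%R]mulrA key //.
by rewrite [(C * (C * C))%R]mulrA CCC mul1r -addrA R2 addr0.
Qed.

(** * Modules over the alternating group as triples of matrices *)

Section TetrahedralMatrices.

Local Open Scope ring_scope.

Variables (n : nat) (A B C X Y N E D : 'M['F_2]_n).
Hypotheses (AA : A *m A = 1%:M) (BB : B *m B = 1%:M) (AB : A *m B = B *m A).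
Hypotheses (AC : A *m C = C *m B) (BC : B *m C = C *m (A *m B)).
Hypothesis CCC : C *m C *m C = 1%:M.
Hypotheses (XE : X = 1%:M + A) (YE : Y = 1%:M + B) (NE : N = X *m Y).
Hypotheses (EE : E = 1%:M + C + C *m C) (DE : D = 1%:M - E).

Lemma tetXX : X *m X = 0.
Proof. by rewrite XE mulmxDl mul1mx mulmxDr mulmx1 AA [A + _]addrC addmm2. Qed.

Lemma tetYY : Y *m Y = 0.
Proof. by rewrite YE mulmxDl mul1mx mulmxDr mulmx1 BB [B + _]addrC addmm2. Qed.

Lemma tetXY : X *m Y = Y *m X.
Proof.
rewrite XE YE !mulmxDl !mulmxDr !mul1mx !mulmx1 AB.
by rewrite !addrA; congr (_ + _); rewrite -!addrA; congr (_ + _); rewrite addrC.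
Qed.

Lemma tetNC : N *m C = C *m N.
Proof.
have XC : X *m C = C *m Y by rewrite XE YE mulmxDl mulmxDr mul1mx mulmx1 AC.
have ABE : 1%:M + A *m B = X + Y + X *m Y.
  rewrite XE YE !mulmxDl !mulmxDr !mul1mx !mulmx1.
  by rewrite -[RHS]addrA addKmx2 -addrA addKmx2.
have YC : Y *m C = C *m (X + Y + X *m Y).
  by rewrite -ABE YE mulmxDl mulmxDr mul1mx mulmx1 BC.
rewrite NE -mulmxA YC mulmxA XC -mulmxA; congr (_ *m _).
by rewrite tetXY !mulmxDr mulmxA tetYY mul0mx !addr0.
Qed.

Lemma tetCE : C *m E = E.
Proof. by rewrite EE mulc_avg. Qed.

Lemma tetEC : E *m C = E.
Proof. by rewrite EE mul_avgc. Qed.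

Lemma tet_idem : E *m E = E.
Proof. by rewrite {2}EE !mulmxDr mulmx1 mulmxA !tetEC addmm2 add0r. Qed.

Lemma tetED : E *m D = 0.
Proof. by rewrite DE mulmxBr mulmx1 tet_idem subrr. Qed.

(** From here on, the module is free over the Klein four-group. *)
Hypothesis fN : n = (4 * \rank N)%N.

Lemma tet_krad : (krad X Y 1%:M :=: kermx N)%MS.
Proof.
have sub : (krad X Y 1%:M <= kermx N)%MS.
  by rewrite NE; apply: krad_sub_ker tetXX tetYY tetXY _ _.
apply/eqmxP; rewrite sub /= -(mxrank_leqif_sup sub) eqn_leq mxrankS //=.
have := @rank_krad_ge _ _ _ _ tetXX tetYY tetXY _ 1%:M (submx1 _) (submx1 _).
rewrite mxrank_ker /nrank mul1mx -NE; move: fN; lia.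
Qed.

Lemma tet_kfix : (kfix X Y :=: N)%MS.
Proof.
have NF : (N <= kfix X Y)%MS.
  rewrite NE sub_capmx; apply/andP; split; apply/sub_kermxP.
    by rewrite tetXY -mulmxA tetXX mulmx0.
  by rewrite -mulmxA tetYY mulmx0.
apply/eqmxP; rewrite NF andbT -(mxrank_leqif_sup NF) eqn_leq mxrankS //=.
have := @rank_ge_nrank _ _ _ _ tetXX tetYY tetXY _ 1%:M (submx1 _) (submx1 _).
rewrite /nrank /frank cap1mx mul1mx mxrank1 -NE; move: fN; lia.
Qed.

(** Nakayama's lemma: the radical is the kernel of the norm [N], so [U] together
    with the radical is everything when [U N] is the whole image of [N]. *)
Lemma tet_generated k (U : 'M_(k, n)) :
  (U *m A <= U)%MS -> (U *m B <= U)%MS -> (N <= U *m N)%MS -> row_full U.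
Proof.
move=> UA UB NU.
have UX : (U *m X <= U)%MS by rewrite XE mulmxDr mulmx1 addmx_sub.
have UY : (U *m Y <= U)%MS by rewrite YE mulmxDr mulmx1 addmx_sub.
have N_U : (N <= U)%MS.
  apply: submx_trans NU _; rewrite NE mulmxA.
  exact: submx_trans (submxMr _ UX) UY.
have one_sub : (1%:M <= U + krad X Y 1%:M)%MS.
  have /submxP[W NW] := NU.
  have {1}-> : 1%:M = W *m U + (1%:M - W *m U) by rewrite addrC subrK.
  apply: addmx_sub_adds; first exact: submxMl.
  rewrite tet_krad.
  by apply/sub_kermxP; rewrite mulmxBl mul1mx -mulmxA -NW subrr.
have X_U : (X <= U)%MS.
  rewrite -[X]mul1mx (submx_trans (submxMr _ one_sub)) // addsmxMr.
  by rewrite addsmx_sub UX addsmxMr !mul1mx tetXX -tetXY -NE addsmx_sub sub0mx.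
have Y_U : (Y <= U)%MS.
  rewrite -[Y]mul1mx (submx_trans (submxMr _ one_sub)) // addsmxMr.
  by rewrite addsmx_sub UY addsmxMr !mul1mx tetYY -NE addsmx_sub N_U sub0mx.
rewrite -sub1mx (submx_trans one_sub) // addsmx_sub submx_refl /=.
by rewrite addsmx_sub !mul1mx X_U.
Qed.

Lemma tet_section : exists2 s : 'M_n, s *m C = C *m s & N *m s *m N = N.
Proof.
have [||||s sC NsN] := @equivariant_section 'M['F_2]_n C N (pinvmx N) => //.
- exact: addmm2.
- exact: tetNC.
- by apply: mulmxKpV.
by exists s.
Qed.

(** Let [S] be a complement of the radical that is stable under [C]; the norm
    identifies it with the image of [N].  The module is the direct sum of [S],
    [S A], [S B] and [S A B], and the last three are permuted cyclically by [C].
    So the invariants of [C] are those of [S] together with one copy of [S].  The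
    proof bounds the ranks of both [E] and [1 - E] from above, and the two bounds
    add up to the dimension. *)
Lemma tet_rankE : \rank E = (\rank N + \rank (N *m E))%N.
Proof.
have [s sC NsN] := tet_section.
pose S := N *m s.
have SC : S *m C = C *m S by rewrite /S -mulmxA sC mulmxA tetNC mulmxA.
have sE : s *m E = E *m s.
  by rewrite EE !mulmxDl !mulmxDr mulmx1 mul1mx mulmxA sC -mulmxA sC mulmxA.
have rS : (\rank S <= \rank N)%N by apply: mxrankM_maxl.
have rSE : (\rank (S *m E) <= \rank (N *m E))%N.
  by rewrite -mulmxA sE mulmxA; apply: mxrankM_maxl.
have rSD : (\rank (S *m D) <= \rank (N *m D))%N.
  have -> : S *m D = N *m D *m s.
    by rewrite /S DE -!mulmxA mulmxBr mulmxBl mulmx1 mul1mx sE.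
  exact: mxrankM_maxl.
have NSN : (N <= S *m N)%MS by rewrite NsN.
clearbody S.
have SCr m (W : 'M_(n, m)) : S *m (C *m W) = C *m (S *m W).
  by rewrite !mulmxA SC.
have full : (1%:M <= S + S *m A + (S *m B + S *m (A *m B)))%MS.
  set U := (S + _ + _)%MS.
  have : (U <= U)%MS by [].
  rewrite {1}/U !addsmx_sub => /andP[/andP[h1 h2] /andP[h3 h4]].
  rewrite sub1mx; apply: tet_generated.
  - rewrite addsmxMr addsmx_sub !addsmxMr !addsmx_sub -!mulmxA AA mulmx1 -AB h1 h2 h4 /=.
    by rewrite [A *m (A *m B)]mulmxA AA mul1mx.
  - by rewrite addsmxMr addsmx_sub !addsmxMr !addsmx_sub -!mulmxA BB !mulmx1 h1 h2 h3 h4.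
  by apply: submx_trans NSN _; rewrite submxMr.
have C3r m (W : 'M_(n, m)) : C *m (C *m (C *m W)) = W.
  by rewrite !mulmxA CCC mul1mx.
have BCe : B = C *m (C *m (A *m C)) by rewrite AC C3r.
have ABCe : A *m B = C *m (C *m (B *m C)) by rewrite BC C3r.
(* [B] and [A B] are conjugates of [A] under powers of [C], which [E] absorbs *)
have SBE : S *m B *m E = C *m (C *m (S *m A *m E)).
  by rewrite {1}BCe -!mulmxA tetCE !SCr.
have SABE : S *m (A *m B) *m E = C *m (S *m A *m E).
  by rewrite {1}ABCe {1}BCe -!mulmxA !tetCE !SCr C3r.
have rE : (\rank E <= \rank N + \rank (N *m E))%N.
  have : (E <= S *m E + S *m A *m E)%MS.
    rewrite -{1}[E]mul1mx (submx_trans (submxMr _ full)) //.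
    rewrite addsmxMr addsmx_sub !addsmxMr SBE SABE.
    set SA := S *m A *m E; have SAV := addsmxSr (S *m E)%R SA.
    rewrite !addsmx_sub addsmxSl SAV /=.
    rewrite !(submx_trans _ SAV) ?submxMl //.
    exact: submx_trans (submxMl _ _) (submxMl _ _).
  move/mxrankS; have := mxrank_adds_leqif (S *m E) (S *m A *m E) => -[h _].
  have : (\rank (S *m A *m E) <= \rank N)%N.
    by rewrite -mulmxA; apply: leq_trans (mxrankM_maxl _ _) rS.
  by move: h rSE; lia.
(* [A E] is the sum of the three translates, and [D] kills it *)
have SABD : S *m (A *m B) *m D = C *m (S *m A *m D) + C *m (C *m (S *m B *m D)).
  have AEE : A *m E = A + C *m B + C *m (C *m (A *m B)).
    by rewrite EE !mulmxDr mulmx1 mulmxA AC -mulmxA BC mulmxA.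
  have -> : A *m B = C *m (A *m E) + C *m A + C *m (C *m B).
    have cancel (p q r : 'M['F_2]_n) : p + q + r + p + q = r.
      by rewrite [p + q + r]addrC -!addrA (addrCA q) addmm2 addr0 addmm2 addr0.
    by rewrite AEE !mulmxDr C3r cancel.
  rewrite !mulmxDr !mulmxDl -!mulmxA tetED !mulmx0 add0r.
  by rewrite !SCr.
have rD : (\rank D <= \rank (N *m D) + 2 * \rank N)%N.
  have : (D <= S *m D + (S *m A *m D + S *m B *m D))%MS.
    rewrite -{1}[D]mul1mx (submx_trans (submxMr _ full)) //.
    rewrite addsmxMr addsmx_sub !addsmxMr SABD.
    set SA := S *m A *m D; set SB := S *m B *m D; set V := (_ + (SA + SB))%MS.
    have : (V <= V)%MS by [].
    rewrite {1}/V !addsmx_sub => /and3P[h1 h2 h3].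
    rewrite h1 h2 h3 /= addmx_sub ?(submx_trans (submxMl _ _) h2) //.
    exact: submx_trans (submxMl _ _) (submx_trans (submxMl _ _) h3).
  move/mxrankS; have := mxrank_adds_leqif (S *m D) (S *m A *m D + S *m B *m D)%MS => -[h _].
  have := mxrank_adds_leqif (S *m A *m D) (S *m B *m D) => -[h' _].
  have hA : (\rank (S *m A *m D) <= \rank N)%N.
    by rewrite -mulmxA; apply: leq_trans (mxrankM_maxl _ _) rS.
  have hB : (\rank (S *m B *m D) <= \rank N)%N.
    by rewrite -mulmxA; apply: leq_trans (mxrankM_maxl _ _) rS.
  by move: h h' rSD; lia.
have NCN : (N *m C <= N)%MS by rewrite tetNC submxMl.
have := rank_avg_compl CCC NCN; have := rank_avg_compl CCC (submx1 (1%:M *m C)).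
rewrite -EE -DE !mul1mx mxrank1; move: fN rD rE; lia.
Qed.

(** By [tet_rankE] the hypothesis says that the invariants of [C] fill a third of
    the image of [N], so this image is free over the group of order three.  Lifts
    of a basis generate the whole module by [tet_generated]. *)
Lemma tet_free_generators : (3 * \rank E = n)%N ->
  exists m (u : 'M_(m, n)), n = (12 * m)%N /\
    forall k (U : 'M_(k, n)), (U *m A <= U)%MS -> (U *m B <= U)%MS ->
      (U *m C <= U)%MS -> (u <= U)%MS -> row_full U.
Proof.
move=> rE; have NCN : (N *m C <= N)%MS by rewrite tetNC submxMl.
have [|m [t []]] := stable_generators CCC NCN.
  by rewrite -EE; move: tet_rankE rE fN; lia.
set T := (t + _ + _)%MS => tN rN.
have : (T <= T)%MS by [].
rewrite {1}/T !addsmx_sub => /andP[/andP[]].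
rewrite tN => /submxP[u tE] _ _; exists m, u; split=> [|k U UA UB UC uU].
  by rewrite fN rN mulnA.
apply: (tet_generated UA UB).
have UNC : (U *m N *m C <= U *m N)%MS.
  by rewrite -mulmxA tetNC mulmxA submxMr.
have tU : (t <= U *m N)%MS by rewrite tE submxMr.
rewrite -tN !addsmx_sub tU /=.
by rewrite !(submx_trans _ UNC) ?submxMr // (submx_trans _ UNC) ?submxMr.
Qed.

End TetrahedralMatrices.

(** * Maps from free modules *)

Section FreeCover.

Local Open Scope ring_scope.

Variables (F : fieldType) (gT : finGroupType) (G : {group gT}).
Implicit Types M N : representation F G.

Let R := Representation (regular_repr F G).

Lemma muln_grepr0 M : muln_grepr M 0 = grepr0.
Proof. by rewrite /muln_grepr big_ord0. Qed.

Lemma muln_greprS M k : muln_grepr M k.+1 = dadd_grepr M (muln_grepr M k).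
Proof. by rewrite /muln_grepr big_ord_recl. Qed.

Lemma rdegree_muln M k : rdegree (muln_grepr M k) = (k * rdegree M)%N.
Proof.
elim: k => [|k IHk]; first by rewrite muln_grepr0.
by rewrite muln_greprS /= IHk mulSn.
Qed.

Lemma module_hom_image M N (f : 'M_(rdegree M, rdegree N)) :
  module_hom f -> forall x, x \in G -> (f *m N x <= f)%MS.
Proof. by move=> hf x Gx; rewrite -hf // submxMl. Qed.

Lemma regular_hom M (u : 'rV_(rdegree M)) :
  exists2 f : 'M_(rdegree R, rdegree M), module_hom f & (u <= f)%MS.
Proof.
pose f : 'M_(rdegree R, rdegree M) := \matrix_(i < #|G|) (u *m M (enum_val i)).
have fE i : row i f = u *m M (enum_val i) by rewrite rowK.
exists f => [x Gx|].
  apply/row_matrixP=> i; rewrite !row_mul fE rowK -rowE fE gring_indexK.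
    by rewrite repr_mxM ?enum_valP // mulmxA.
  by rewrite groupM ?enum_valP.
suff -> : u = row (gring_index G 1) f by apply: row_sub.
by rewrite fE gring_indexK // repr_mx1 mulmx1.
Qed.

Lemma muln_regular_hom M m (u : 'M_(m, rdegree M)) :
  exists2 f : 'M_(rdegree (muln_grepr R m), rdegree M),
    module_hom f & (u <= f)%MS.
Proof.
elim: m u => [|m IHm] u; first by rewrite muln_grepr0; exists 0;
  rewrite ?flatmx0 ?sub0mx // => x _; rewrite mulmx0 mul0mx.
pose v : 'M_(1 + m, rdegree M) := u.
have [f1 hf1 uf1] := regular_hom (usubmx v).
have [f2 hf2 uf2] := IHm (dsubmx v).
rewrite muln_greprS; exists (col_mx f1 f2) => [x Gx|].
  rewrite /= -[R x]/(regular_repr F G x) mul_block_col !mul0mx addr0 add0r.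
  by rewrite mul_col_mx -hf1 // -hf2.
have : (col_mx (usubmx v) (dsubmx v) <= col_mx f1 f2)%MS.
  rewrite col_mx_sub -!addsmxE (submx_trans uf1 (addsmxSl _ _)).
  exact: submx_trans uf2 (addsmxSr _ _).
by rewrite vsubmxK.
Qed.

(** A surjection from a free module of the same dimension is an isomorphism. *)
Lemma free_of_generators M m (u : 'M_(m, rdegree M)) :
    rdegree M = (m * #|G|)%N ->
    (forall f : 'M_(rdegree (muln_grepr R m), rdegree M),
       module_hom f -> (u <= f)%MS -> row_full f) ->
  free_module M.
Proof.
move=> dM full; have [f hf uf] := muln_regular_hom u.
have ff := full f hf uf.
have dF : rdegree (muln_grepr R m) = rdegree M by rewrite rdegree_muln dM.
exists m; apply: mx_rsim_sym; exists f => //.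
by move: ff; rewrite -col_leq_rank -row_leq_rank => /(leq_trans _)-> //; rewrite dF.
Qed.

End FreeCover.

(** * Projective and free modules over the alternating group *)

(** The Klein four-group [V] is [<a, b>], and conjugation by [c] maps [a] to [b]
    and [b] to [a b]; these two relations are written without inverses so that
    they transfer to matrices at once. *)
Record tetrahedral (gT : finGroupType) (G : {group gT}) (a b c : gT) : Prop :=
  Tetrahedral {
    tet_a : a \in G;
    tet_b : b \in G;
    tet_c : c \in G;
    tet_card : #|G| = 12;
    tet_aa : (a * a)%g = 1%g;
    tet_bb : (b * b)%g = 1%g;
    tet_ab : (a * b)%g = (b * a)%g;
    tet_ac : (a * c)%g = (c * b)%g;
    tet_bc : (b * c)%g = (c * (a * b))%g;
    tet_ccc : (c * c * c)%g = 1%g;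
    tet_neq1 : [/\ a != 1%g, b != 1%g, a != b & c != 1%g]
  }.

Section KleinRep.

Local Open Scope ring_scope.

Variables (gT : finGroupType) (G : {group gT}) (a b c : gT).
Hypothesis tetG : tetrahedral G a b c.

Let Ga := tet_a tetG.
Let Gb := tet_b tetG.
Let Gc := tet_c tetG.
Let a2 := tet_aa tetG.
Let b2 := tet_bb tetG.
Let ab := tet_ab tetG.
Let ac := tet_ac tetG.
Let bc := tet_bc tetG.
Let c3 := tet_ccc tetG.

Notation rep := (representation 'F_2 G).
Implicit Types M N : rep.

(** [opN] is the norm element of [V].  [opE] is the projection onto the
    invariants of [c]. *)
Definition opX M : 'M['F_2]_(rdegree M) := 1%:M + M a.
Definition opY M : 'M['F_2]_(rdegree M) := 1%:M + M b.
Definition opN M : 'M['F_2]_(rdegree M) := opX M *m opY M.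
Definition opE M : 'M['F_2]_(rdegree M) := 1%:M + M c + M c *m M c.
Section Operators.

Variable M : rep.

Lemma rep_aa : M a *m M a = 1%:M.
Proof. by rewrite -repr_mxM // a2 repr_mx1. Qed.

Lemma rep_bb : M b *m M b = 1%:M.
Proof. by rewrite -repr_mxM // b2 repr_mx1. Qed.

Lemma rep_ab : M a *m M b = M b *m M a.
Proof. by rewrite -!repr_mxM // ab. Qed.

Lemma rep_ac : M a *m M c = M c *m M b.
Proof. by rewrite -!repr_mxM // ac. Qed.

Lemma rep_bc : M b *m M c = M c *m (M a *m M b).
Proof. by rewrite -!repr_mxM ?groupM // bc. Qed.

Lemma rep_ccc : M c *m M c *m M c = 1%:M.
Proof. by rewrite -!repr_mxM ?groupM // c3 repr_mx1. Qed.

Lemma opXX : opX M *m opX M = 0.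
Proof. exact: tetXX rep_aa (erefl _). Qed.

Lemma opYY : opY M *m opY M = 0.
Proof. exact: tetYY rep_bb (erefl _). Qed.

Lemma opXY : opX M *m opY M = opY M *m opX M.
Proof. exact: tetXY rep_ab (erefl _) (erefl _). Qed.

End Operators.

Lemma hom_opX M N (f : 'M_(rdegree M, rdegree N)) :
  module_hom f -> opX M *m f = f *m opX N.
Proof. by move=> hf; rewrite /opX mulmxDl mulmxDr mul1mx mulmx1 hf. Qed.

Lemma hom_opY M N (f : 'M_(rdegree M, rdegree N)) :
  module_hom f -> opY M *m f = f *m opY N.
Proof. by move=> hf; rewrite /opY mulmxDl mulmxDr mul1mx mulmx1 hf. Qed.

Lemma hom_opN M N (f : 'M_(rdegree M, rdegree N)) :
  module_hom f -> opN M *m f = f *m opN N.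
Proof.
move=> hf; rewrite /opN.
by rewrite -[LHS]mulmxA hom_opY // mulmxA hom_opX // -[LHS]mulmxA.
Qed.

Lemma hom_opE M N (f : 'M_(rdegree M, rdegree N)) :
  module_hom f -> opE M *m f = f *m opE N.
Proof.
move=> hf; rewrite /opE !mulmxDl !mulmxDr mul1mx mulmx1 hf //.
by rewrite -[_ *m _ *m f]mulmxA hf // !mulmxA hf.
Qed.

(** Freeness over the Klein four-group, by [rank_le_frank]. *)
Definition vfree M := rdegree M = (4 * \rank (opN M))%N.

(** If the two-dimensional simple module [W] occurs [q] times in [M] and the
    trivial one [p] times, then the invariants of [c] have dimension [p] and
    [psi M = 2 * (p - q)].  Over the group [<c>] this is twice the value at [c]
    of the Brauer character. *)
Definition psi M : int := 3%:Z * (\rank (opE M))%:Z - (rdegree M)%:Z.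

Lemma rank_opN_dadd M N :
  \rank (opN (dadd_grepr M N)) = (\rank (opN M) + \rank (opN N))%N.
Proof.
rewrite -rank_diag_block_mx; congr (\rank _).
rewrite /opN /opX /opY /= scalar_mx_block !add_block_mx !addr0 mulmx_block.
by rewrite !mulmx0 !mul0mx !addr0 !add0r.
Qed.

Lemma rank_opE_dadd M N :
  \rank (opE (dadd_grepr M N)) = (\rank (opE M) + \rank (opE N))%N.
Proof.
rewrite -rank_diag_block_mx; congr (\rank _).
rewrite /opE /= scalar_mx_block !add_block_mx !addr0 mulmx_block.
by rewrite !mulmx0 !mul0mx !addr0 !add0r add_block_mx !addr0.
Qed.

Lemma rank_rsim M N : mx_rsim M N ->
  [/\ rdegree M = rdegree N, \rank (opN M) = \rank (opN N)
    & \rank (opE M) = \rank (opE N)].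
Proof.
case: M N => n1 r1 [n2 r2] /= [B n12 fB hB]; subst n2.
pose M1 := Representation r1; pose M2 := Representation r2.
have hf : @module_hom _ _ _ M1 M2 B by [].
have rB (A A' : 'M['F_2]_n1) : A *m B = B *m A' -> \rank A = \rank A'.
  move=> AB; rewrite -(mxrankMfree A fB) AB.
  have fullB : row_full B by rewrite row_full_unit -row_free_unit.
  by rewrite (eqmxMfull A' fullB).
by split=> //; apply: rB; [apply: hom_opN hf | apply: hom_opE hf].
Qed.

Lemma psi_rsim M N : mx_rsim M N -> psi M = psi N.
Proof. by case/rank_rsim=> d _ r; rewrite /psi r d. Qed.

Lemma vfree_rsim M N : mx_rsim M N -> vfree M <-> vfree N.
Proof. by case/rank_rsim=> d r _; rewrite /vfree r d. Qed.

Lemma psi_dadd M N : psi (dadd_grepr M N) = psi M + psi N.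
Proof. by rewrite /psi rank_opE_dadd /= !PoszD mulrDr opprD addrACA. Qed.

Lemma psi_grepr0 : psi grepr0 = 0.
Proof. by rewrite /psi /= [opE _]flatmx0 mxrank0. Qed.

Lemma psi_muln M k : psi (muln_grepr M k) = psi M *+ k.
Proof.
elim: k => [|k IHk]; first by rewrite muln_grepr0 psi_grepr0.
by rewrite muln_greprS psi_dadd IHk mulrS.
Qed.

Lemma rdegree_ge_opN M : (4 * \rank (opN M) <= rdegree M)%N.
Proof.
have h := @rank_ge_nrank _ _ _ _ (opXX M) (opYY M) (opXY M) _ 1%:M.
have h' := @nrank_le_frank _ _ _ _ (opXX M) (opYY M) (opXY M) _ 1%:M.
move: (h (submx1 _) (submx1 _)) (h' (submx1 _) (submx1 _)).
rewrite /nrank mul1mx mxrank1 -/(opN M).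
lia.
Qed.

(** In every module the dimension is at least four times the rank of the norm;
    for a direct sum, equality therefore passes to both summands. *)
Lemma vfree_dadd M N : vfree (dadd_grepr M N) <-> vfree M /\ vfree N.
Proof.
rewrite /vfree rank_opN_dadd /=.
move: (rdegree_ge_opN M) (rdegree_ge_opN N).
lia.
Qed.

Lemma vfree_muln M k : vfree M -> vfree (muln_grepr M k).
Proof.
move=> fM; elim: k => [|k IHk]; last by rewrite muln_greprS; apply/vfree_dadd.
by rewrite muln_grepr0 /vfree /= [opN _]flatmx0 mxrank0.
Qed.

Lemma rank_opE_vfree M : vfree M ->
  \rank (opE M) = (\rank (opN M) + \rank (opN M *m opE M))%N.
Proof.
exact: (tet_rankE (rep_aa M) (rep_bb M) (rep_ab M) (rep_ac M) (rep_bc M)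
          (rep_ccc M) (erefl _) (erefl _) (erefl _) (erefl _) (erefl _)).
Qed.

Lemma rank_opE_parity M : exists k, rdegree M = (\rank (opE M) + 2 * k)%N.
Proof.
have CCC := rep_ccc M; have sC := submx1 (1%:M *m M c).
have [k rk] := rank_compl_even CCC sC.
by exists k; rewrite -rk -{1}[opE M]mul1mx -(rank_avg_compl CCC sC) mxrank1.
Qed.

(** The class of a projective module is determined by its composition factors;
    when [psi] vanishes, both indecomposable projectives occur equally often, as
    they do in the regular representation. *)
Lemma vfree_psi0_free M : vfree M -> psi M = 0 -> free_module M.
Proof.
move=> fM psi0; have rE : (3 * \rank (opE M))%N = rdegree M.
  by move: psi0 => /eqP; rewrite subr_eq0 -PoszM eqz_nat => /eqP.
have [m [u [dM full]]] := tet_free_generators (rep_aa M) (rep_bb M) (rep_ab M)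
  (rep_ac M) (rep_bc M) (rep_ccc M) (erefl _) (erefl _) (erefl _) (erefl _)
  (erefl (1%:M - _)) fM rE.
apply: (@free_of_generators _ _ _ _ m u); first by rewrite (tet_card tetG) dM mulnC.
by move=> f hf uf; apply: full uf; apply: module_hom_image.
Qed.

Notation regular := (Representation (regular_repr 'F_2 G)).

Lemma rank_regular_group (V : {set gT}) (s : seq gT) :
    group_set V -> V \subset G -> uniq s -> V =i s ->
  (\rank (\sum_(x <- s) regular x)%R * size s)%N = 12.
Proof.
move=> gV sVG us Vs; pose VG := Group gV.
have -> : \sum_(x <- s) regular x = \sum_(x in VG) regular_repr 'F_2 G x.
  by rewrite big_uniq //; apply: eq_bigl => x; rewrite -Vs.
have -> : size s = #|VG| by rewrite -(card_uniqP us); apply: eq_card => x; rewrite -Vs.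
by rewrite rank_regular_sum // mulnC Lagrange // (tet_card tetG).
Qed.

Lemma vfree_regular : vfree regular.
Proof.
have [a1 b1 nab c1] := tet_neq1 tetG.
have ab1 : (a * b)%g != 1%g.
  by apply: contra nab => /eqP ab1; rewrite -(mulKg a b) ab1 mulg1 eq_sym eq_invg_mul a2.
have aba : (a * (a * b))%g = b by rewrite mulgA a2 mul1g.
have bab : (b * (a * b))%g = a by rewrite ab mulgA b2 mul1g.
have aab : (a * b * a)%g = b by rewrite ab -mulgA a2 mulg1.
have abb : (a * b * b)%g = a by rewrite -mulgA b2 mulg1.
have abab : (a * b * (a * b))%g = 1%g by rewrite -mulgA bab a2.
pose s := [:: 1%g; a; b; (a * b)%g].
have := @rank_regular_group [set x in s] s.
have -> : \sum_(x <- s) regular x = opN regular.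
  rewrite /s !big_cons big_nil addr0 repr_mx1 repr_mxM // /opN /opX /opY.
  rewrite mulmxDl mul1mx mulmxDr mulmx1 -!addrA; congr (_ + _).
  by rewrite addrCA.
move=> h; apply: etrans (tet_card tetG) _; rewrite mulnC; apply/esym/h.
- apply/group_setP; split=> [|x y]; first by rewrite !inE eqxx.
  rewrite !inE => /or4P[]/eqP-> /or4P[]/eqP->;
    by rewrite ?mul1g ?mulg1 ?a2 ?b2 -?ab ?aba ?bab ?aab ?abb ?abab ?eqxx ?orbT.
- by apply/subsetP=> x; rewrite !inE => /or4P[]/eqP->; rewrite ?groupM ?group1.
- rewrite /= !inE !negb_or !(eq_sym 1%g) a1 b1 ab1 nab /=.
  rewrite -{1}[a]mulg1 (inj_eq (mulgI a)) eq_sym b1 /=.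
  by rewrite -{1}[b]mul1g (inj_eq (mulIg b)) eq_sym a1.
- by move=> x; rewrite inE.
Qed.

Lemma psi_regular : psi regular = 0.
Proof.
have [_ _ _ c1] := tet_neq1 tetG.
have c2c : (c * (c * c))%g = 1%g by rewrite mulgA c3.
have cc1 : (c * c)%g != 1%g.
  by apply: contra c1 => /eqP cc; rewrite -c3 cc mul1g.
pose s := [:: 1%g; c; (c * c)%g].
have := @rank_regular_group [set x in s] s.
have -> : \sum_(x <- s) regular x = opE regular.
  by rewrite /s !big_cons big_nil addr0 repr_mx1 repr_mxM // /opE addrA.
move=> h; apply/eqP; rewrite /psi subr_eq0 -PoszM eqz_nat; apply/eqP.
apply: etrans _ (esym (tet_card tetG)); rewrite mulnC; apply: h.
- apply/group_setP; split=> [|x y]; first by rewrite !inE eqxx.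
  rewrite !inE => /or3P[]/eqP-> /or3P[]/eqP->;
    by rewrite ?mul1g ?mulg1 -?mulgA ?c2c ?mulg1 ?eqxx ?orbT.
- by apply/subsetP=> x; rewrite !inE => /or3P[]/eqP->; rewrite ?groupM ?group1.
- rewrite /= !inE !negb_or !(eq_sym 1%g) c1 cc1 /=.
  by rewrite -{1}[c]mulg1 (inj_eq (mulgI c)) eq_sym c1.
- by move=> x; rewrite inE.
Qed.

Lemma vfree_projective M : projective_module M -> vfree M.
Proof.
case=> N [k /vfree_rsim [_ h]].
by case/vfree_dadd: (h (vfree_muln k vfree_regular)).
Qed.

Lemma psi_free M : free_module M -> psi M = 0.
Proof. by case=> k /psi_rsim ->; rewrite psi_muln psi_regular mul0rn. Qed.

End KleinRep.

(** * Cohomology as a subquotient *)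

Section Idempotent.

Local Open Scope ring_scope.

(** Taking invariants of a group of odd order is exact in characteristic two;
    this is the form of exactness that counts dimensions. *)
Lemma rank_idem_hom (F : fieldType) (m n : nat) (E : 'M[F]_m) (E' : 'M[F]_n)
    (f : 'M[F]_(m, n)) : E *m E = E -> E *m f = f *m E' ->
  \rank E = (\rank (f *m E') + \rank (kermx f *m E))%N.
Proof.
move=> EE Ef; rewrite -(mxrank_mul_ker E f) Ef; congr (_ + _)%N.
apply/eqP; rewrite eqn_leq !mxrankS //.
  rewrite sub_capmx submxMl; apply/sub_kermxP.
  by rewrite -mulmxA Ef mulmxA mulmx_ker mul0mx.
have {1}-> : (E :&: kermx f)%MS = (E :&: kermx f)%MS *m E.
  have /submxP[W ->] : (E :&: kermx f <= E)%MS by apply: capmxSl.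
  by rewrite -mulmxA EE.
by rewrite submxMr ?capmxSr.
Qed.

Lemma idem_disjoint (F : fieldType) k l n (E : 'M[F]_n) (U : 'M_(k, n))
    (V : 'M_(l, n)) : E *m E = E -> (U *m E :&: V *m (1%:M - E))%MS = 0.
Proof.
move=> EE; apply/eqP; rewrite -submx0; set K := (_ :&: _)%MS.
have /submxP[W1 K1] : (K <= U *m E)%MS by apply: capmxSl.
have /submxP[W2 K2] : (K <= V *m (1%:M - E))%MS by apply: capmxSr.
have KE : K = K *m E by rewrite K1 -!mulmxA EE.
by rewrite KE K2 -!mulmxA mulmxBl mul1mx EE subrr !mulmx0 sub0mx.
Qed.

Lemma avg_intertwine (F : fieldType) k m n (Z : 'M[F]_(k, m)) (c : 'M[F]_m)
    (P : 'M[F]_(m, n)) (c' : 'M[F]_n) :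
    Z *m c *m P = Z *m P *m c' -> Z *m c *m c *m P = Z *m c *m P *m c' ->
  Z *m (1%:M + c + c *m c) *m P = Z *m P *m (1%:M + c' + c' *m c').
Proof.
move=> h1 h2; rewrite !mulmxDr !mulmx1 !mulmxDl mulmxA h2 h1.
by rewrite (mulmxA (Z *m P)).
Qed.

End Idempotent.

Section CohomologyProjection.

Local Open Scope ring_scope.

Variables (F : fieldType) (gT : finGroupType) (G : {group gT}).
Variables (C : cochain_complex F G) (i : int).

Lemma coboundaries_sub : (coboundaries C i <= cocycles C i)%MS.
Proof. by rewrite genmxE; apply/sub_kermxP; rewrite cdiff_sq0. Qed.

(** [P] extends the projection from cocycles onto cohomology to all cochains. *)
Lemma cohomology_projection :
  exists P : 'M[F]_(rdegree (C i), rdegree (cohomology C i)),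
    [/\ forall k (V : 'M_(k, _)) x, x \in G -> (V <= cocycles C i)%MS ->
          V *m C i x *m P = V *m P *m cohomology C i x,
        forall k (V : 'M_(k, _)), (V <= cocycles C i)%MS ->
          (\rank (V *m P) + \rank (coboundaries C i))%N
          = \rank (V + coboundaries C i)%MS
      & row_full (cocycles C i *m P)].
Proof.
set B := coboundaries C i; set Z := cocycles C i.
pose W := <<in_factmod B Z>>%MS.
pose P := in_factmod B (1%:M : 'M_(rdegree (C i))) *m in_submod W 1%:M.
have PE k (V : 'M_(k, _)) : V *m P = in_submod W (in_factmod B V).
  by rewrite mulmxA -in_factmodE -in_submodE.
have VW k (V : 'M_(k, _)) : (V <= Z)%MS -> (in_factmod B V <= W)%MS.
  by move=> VZ; rewrite genmxE in_factmodE (in_factmodE B Z) submxMr.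
have rP k (V : 'M_(k, _)) : (V <= Z)%MS ->
    (\rank (V *m P) + \rank B)%N = \rank (V + B)%MS.
  move=> VZ; rewrite PE addsmxC -mxrank_in_factmod; congr (_ + _)%N.
  exact: mxrank_in_submod (VW _ _ VZ).
exists P; split=> // [k V x Gx VZ|].
  rewrite !PE; have -> : in_factmod B (V *m C i x)
      = in_factmod B V *m factmod_repr (coboundaries_module C i) x.
    exact: in_factmodJ.
  exact: in_submodJ (VW _ _ VZ).
rewrite -col_leq_rank -(leq_add2r (\rank B)) rP // /cohomology /= addsmxC.
by rewrite -mxrank_in_factmod leq_add2r mxrank_gen.
Qed.

(** An endomorphism of the cochains that is compatible with the action on
    cohomology has rank [rank (Z A + B) - rank B] there. *)
Lemma rank_cohomology_op (A : 'M[F]_(rdegree (C i)))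
    (A' : 'M[F]_(rdegree (cohomology C i))) :
    (cocycles C i *m A <= cocycles C i)%MS ->
    (forall P : 'M_(_, _),
       (forall k (V : 'M_(k, _)) x, x \in G -> (V <= cocycles C i)%MS ->
          V *m C i x *m P = V *m P *m cohomology C i x) ->
       cocycles C i *m A *m P = cocycles C i *m P *m A') ->
  (\rank A' + \rank (coboundaries C i))%N
    = \rank (cocycles C i *m A + coboundaries C i)%MS.
Proof.
move=> ZA hA; have [P [hP rP fP]] := cohomology_projection.
rewrite -rP // hA //; congr (_ + _)%N.
by rewrite (eqmxMfull A' fP).
Qed.

Lemma rdegree_cohomology :
  (rdegree (cohomology C i) + \rank (coboundaries C i))%N
    = \rank (cocycles C i).
Proof.
have := @rank_cohomology_op 1%:M 1%:M.
rewrite !mulmx1 mxrank1 => h; rewrite h ?submx_refl // => [|P _]; last by rewrite mulmx1.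
by have /addsmx_idPl -> := coboundaries_sub.
Qed.

Lemma rank_cdiff :
  (\rank (cocycles C i) + \rank (coboundaries C (i + 1)))%N = rdegree (C i).
Proof.
rewrite mxrank_ker genmxE.
have -> : \rank (cdiff C (i + 1 - 1) (i + 1)) = \rank (cdiff C i (i + 1)).
  by rewrite addrK.
by rewrite subnK ?rank_leq_row.
Qed.

End CohomologyProjection.

Section Restricted.

Local Open Scope ring_scope.

Variables (gT : finGroupType) (G : {group gT}) (a b c : gT).
Hypothesis tetG : tetrahedral G a b c.
Variables (C : cochain_complex 'F_2 G) (i : int).

Let Z := cocycles C i.
Let B := coboundaries C i.
Let H := cohomology C i.
Let Ga := tet_a tetG.
Let Gb := tet_b tetG.
Let Gc := tet_c tetG.

Lemma module_opX (U : 'M_(rdegree (C i))) :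
  mxmodule (C i) U -> (U *m opX a (C i) <= U)%MS.
Proof.
by move=> /mxmoduleP mU; rewrite /opX mulmxDr mulmx1 addmx_sub ?mU.
Qed.

Lemma module_opY (U : 'M_(rdegree (C i))) :
  mxmodule (C i) U -> (U *m opY b (C i) <= U)%MS.
Proof.
by move=> /mxmoduleP mU; rewrite /opY mulmxDr mulmx1 addmx_sub ?mU.
Qed.

Lemma module_c (U : 'M_(rdegree (C i))) :
  mxmodule (C i) U -> (U *m C i c <= U)%MS.
Proof. by move=> /mxmoduleP mU; apply: mU. Qed.

Lemma module_opE (U : 'M_(rdegree (C i))) :
  mxmodule (C i) U -> (U *m opE c (C i) <= U)%MS.
Proof. by move=> mU; apply: stable_avg (module_c mU). Qed.

Let mZ := cocycles_module C i.
Let mB := coboundaries_module C i.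

Lemma cohomology_opX :
  (\rank (opX a H) + \rank B)%N = \rank (Z *m opX a (C i) + B)%MS.
Proof.
apply: rank_cohomology_op => [|P hP]; first exact: module_opX.
by rewrite /opX mulmxDr mulmx1 mulmxDl hP // [in RHS]mulmxDr mulmx1.
Qed.

Lemma cohomology_opY :
  (\rank (opY b H) + \rank B)%N = \rank (Z *m opY b (C i) + B)%MS.
Proof.
apply: rank_cohomology_op => [|P hP]; first exact: module_opY.
by rewrite /opY mulmxDr mulmx1 mulmxDl hP // [in RHS]mulmxDr mulmx1.
Qed.

Lemma cohomology_opE :
  (\rank (opE c H) + \rank (B *m opE c (C i)))%N = \rank (Z *m opE c (C i)).
Proof.
have h : (\rank (opE c H) + \rank B)%N = \rank (Z *m opE c (C i) + B)%MS.
  apply: rank_cohomology_op => [|P hP]; first exact: module_opE.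
  have Zc : (Z *m C i c <= Z)%MS := module_c mZ.
  exact: avg_intertwine (hP _ _ _ Gc (submx_refl Z)) (hP _ _ _ Gc Zc).
set E := opE c (C i) in h *; set D := 1%:M - E.
have CCC := rep_ccc tetG (C i).
have EE : E *m E = E := avg_idem CCC.
have rB : \rank B = (\rank (B *m E) + \rank (B *m D))%N.
  by have := rank_avg_compl CCC (module_c mB).
suff ZB : \rank (Z *m E + B)%MS = (\rank (Z *m E) + \rank (B *m D))%N.
  by move: h rB ZB; lia.
have -> : \rank (Z *m E + B)%MS = \rank (Z *m E + B *m D)%MS.
  apply: eqmx_rank; rewrite !addsmx_sub !addsmxSl /=.
  rewrite (submx_trans (stable_compl (module_c mB))) ?addsmxSr // andbT.
  rewrite (stable_split (module_c mB)) addsmx_sub addsmxSr andbT.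
  by rewrite (submx_trans _ (addsmxSl _ _)) // submxMr // coboundaries_sub.
by apply: mxrank_disjoint_sum; apply: idem_disjoint.
Qed.

Lemma rank_opE_cdiff :
  (\rank (Z *m opE c (C i))
   + \rank (coboundaries C (i + 1) *m opE c (C (i + 1)%R)))%N
  = \rank (opE c (C i)).
Proof.
have hd : module_hom (cdiff C i (i + 1)) by apply: cdiff_hom.
rewrite (rank_idem_hom (avg_idem (rep_ccc tetG (C i))) (hom_opE tetG hd)).
rewrite addnC; congr (_ + _)%N.
rewrite (eqmxMr _ (genmxE _)).
by rewrite addrK.
Qed.

End Restricted.

(** * Syzygies over the Klein four-group *)

Section VfreeHom.

Local Open Scope ring_scope.

Variables (gT : finGroupType) (G : {group gT}) (a b c : gT).
Hypothesis tetG : tetrahedral G a b c.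

Notation rep := (representation 'F_2 G).
Implicit Types M N : rep.

(** Dimensions of the invariants, of the image of the norm and of the radical of
    a submodule [U] for the Klein four-group. *)
Definition krank M k (U : 'M_(k, rdegree M)) := frank (opX a M) (opY b M) U.
Definition prank M k (U : 'M_(k, rdegree M)) := nrank (opX a M) (opY b M) U.
Definition jrank M k (U : 'M_(k, rdegree M)) := \rank (krad (opX a M) (opY b M) U).

Definition vstable M k (U : 'M_(k, rdegree M)) :=
  (U *m opX a M <= U)%MS /\ (U *m opY b M <= U)%MS.

Lemma vstable_ranks M k (U : 'M_(k, rdegree M)) : vstable U ->
  [/\ (prank U <= krank U)%N,
      (3 * prank U + krank U <= \rank U)%N,
      (\rank U <= 3 * krank U + prank U)%N,
      (3 * prank U <= jrank U)%N
    & (jrank U <= krank U + 2 * prank U)%N].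
Proof.
case=> UX UY; have XX := opXX tetG M; have YY := opYY tetG M.
have XY := opXY tetG M; split.
- exact: (@nrank_le_frank _ _ _ _ XX YY XY).
- exact: (@rank_ge_nrank _ _ _ _ XX YY XY).
- exact: (@rank_le_frank _ _ _ _ XX YY XY).
- exact: (@rank_krad_ge _ _ _ _ XX YY XY).
exact: (@rank_krad_le _ _ _ _ XX YY XY).
Qed.

Lemma vstable_hom M N (f : 'M_(rdegree M, rdegree N)) :
  module_hom f -> vstable f.
Proof. by move=> hf; split; rewrite -?(hom_opX tetG hf) -?(hom_opY tetG hf) submxMl. Qed.

Lemma vstable_ker M N (f : 'M_(rdegree M, rdegree N)) :
  module_hom f -> vstable (kermx f).
Proof.
by move=> hf; split; apply/sub_kermxP;
  rewrite -mulmxA ?(hom_opX tetG hf) ?(hom_opY tetG hf) mulmxA mulmx_ker mul0mx.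
Qed.

(** A free module over [V] is also injective, and its invariants are the image of
    the norm while its radical is the kernel of the norm.  This expresses the
    three ranks of a quotient by those of the submodule. *)
Lemma vfree_hom_ranks M N (f : 'M_(rdegree M, rdegree N)) :
    vfree a b M -> module_hom f ->
  [/\ (\rank f + \rank (kermx f))%N = (4 * \rank (opN a b M))%N,
      (prank f + krank (kermx f))%N = \rank (opN a b M)
    & (jrank f + \rank (kermx f))%N
      = (3 * \rank (opN a b M) + prank (kermx f))%N].
Proof.
move=> fM hf; have AA := rep_aa tetG M; have BB := rep_bb tetG M.
have AB := rep_ab tetG M.
have kfixE := tet_kfix AA BB AB (erefl (opX a M)) (erefl _) (erefl _) fM.
have kradE := tet_krad AA BB AB (erefl (opX a M)) (erefl _) (erefl _) fM.
split.
- by rewrite mxrank_ker subnKC ?rank_leq_row.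
- rewrite /prank /nrank -/(opN a b N) -(hom_opN tetG hf).
  rewrite -[RHS](mxrank_mul_ker _ f); congr (_ + _)%N.
  rewrite /krank /frank capmxC.
  by rewrite (cap_eqmx kfixE (eqmx_refl _)).
have jE : jrank f = \rank (krad (opX a M) (opY b M) 1%:M *m f).
  rewrite /jrank /krad addsmxMr !mul1mx.
  by rewrite (hom_opX tetG hf) (hom_opY tetG hf).
have -> : jrank f = \rank (kermx (opN a b M) *m f).
  by rewrite jE (eqmxMr f kradE).
set K := kermx (opN a b M); set U := kermx f.
have rK : \rank K = (3 * \rank (opN a b M))%N.
  by rewrite mxrank_ker {1}fM mulSn addKn.
have h1 : (\rank (K *m f) + \rank (K :&: U)%MS)%N = \rank K := mxrank_mul_ker _ _.
have h2 : (prank U + \rank (U :&: K)%MS)%N = \rank U := mxrank_mul_ker _ _.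
by rewrite capmxC in h2; rewrite -h2 addnCA h1 rK addnC.
Qed.

(** In an exact sequence with free middle term, one end is free exactly when the
    other one is. *)
Lemma ker_free_iff M N (f : 'M_(rdegree M, rdegree N)) :
    vfree a b M -> module_hom f ->
  \rank f = (4 * prank f)%N <-> \rank (kermx f) = (4 * prank (kermx f))%N.
Proof.
move=> fM hf; have [h1 h2 h3] := vfree_hom_ranks fM hf.
have [k1 k2 k3 k4 k5] := vstable_ranks (vstable_ker hf).
have arith n rf rU pf kU pU : (rf + rU = 4 * n -> pf + kU = n -> pU <= kU ->
  3 * pU + kU <= rU -> rU <= 3 * kU + pU -> rf = 4 * pf <-> rU = 4 * pU)%N by lia.
exact: arith h1 h2 k1 k2 k3.
Qed.

(** The function [phi U = 2 dim U^V + 2 dim U N - dim U], with [N] the norm of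
    [V], vanishes on free modules.  It equals 1 on the trivial module and -1 on
    its syzygy.  It does not decrease when a module is replaced by its
    cosyzygy. *)
Lemma phi_image M N (f : 'M_(rdegree M, rdegree N)) :
    vfree a b M -> module_hom f ->
  (2 * krank (kermx f) + 2 * prank (kermx f) + \rank f
    <= 2 * krank f + 2 * prank f + \rank (kermx f))%N.
Proof.
move=> fM hf; have [h1 h2 h3] := vfree_hom_ranks fM hf.
have [k1 k2 k3 k4 k5] := vstable_ranks (vstable_ker hf).
have [f1 f2 f3 f4 f5] := vstable_ranks (vstable_hom hf).
have arith n rf rU pf kU pU jf kf : (rf + rU = 4 * n -> pf + kU = n ->
  jf + rU = 3 * n + pU -> jf <= kf + 2 * pf ->
  2 * kU + 2 * pU + rf <= 2 * kf + 2 * pf + rU)%N by lia.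
exact: arith h1 h2 h3 f5.
Qed.

Lemma rank_submod_op M (U : 'M_(rdegree M)) (mU : mxmodule M U) :
  let K := Representation (submod_repr mU) in
  \rank (opN a b K) = \rank (U *m opN a b M) /\
  \rank (opE c K) = \rank (U *m opE c M).
Proof.
move=> K; pose J : 'M_(rdegree K, rdegree M) := val_submod (1%:M : 'M_(\rank U)).
have JU : (J :=: U)%MS by apply: val_submod1.
have hJ : module_hom J.
  move=> x Gx; rewrite -[K x]mul1mx -[LHS]val_submodE.
  exact: val_submodJ.
have fJ : row_free J by rewrite -row_leq_rank JU.
split; rewrite -(mxrankMfree _ fJ) ?(hom_opN tetG hJ) ?(hom_opE tetG hJ).
  by rewrite (eqmxMr _ JU).
by rewrite (eqmxMr _ JU).
Qed.

(** The module generated by one element of [P] is the quotient of the regular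
    representation by a projective module, and [psi] is additive. *)
Lemma psi_kernel (P : rep) : vfree a b P -> rdegree P = 4 -> psi c P = 2 ->
  exists2 K : rep, vfree a b K & psi c K = - 2%:Z.
Proof.
move=> fP dP psiP; pose R := Representation (regular_repr 'F_2 G).
have fR : vfree a b R := vfree_regular tetG.
have dR : rdegree R = 12 := tet_card tetG.
have psiR : psi c R = 0 := psi_regular tetG.
have rNP : \rank (opN a b P) = 1.
  by have := etrans (esym fP) dP; move: (\rank _) => r; lia.
have [i uN] : exists i, row i (opN a b P) != 0.
  have : opN a b P != 0 by rewrite -mxrank_eq0 rNP.
  case/rowV0Pn=> v /submxP[w ->] nz; apply/existsP; apply: contraNT nz.
  rewrite negb_exists => /forallP h; apply/eqP.
  suff -> : opN a b P = 0 by rewrite mulmx0.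
  by apply/row_matrixP=> i; rewrite row0; apply/eqP; move: (h i); rewrite negbK.
have [f hf uf] := @regular_hom _ _ _ P (delta_mx 0 i).
have full : row_full f.
  apply: (tet_generated (rep_aa tetG P) (rep_bb tetG P) (rep_ab tetG P)
    (erefl _) (erefl _) (erefl _) fP).
  - exact: module_hom_image hf _ (tet_a tetG).
  - exact: module_hom_image hf _ (tet_b tetG).
  have rowN : (opN a b P <= row i (opN a b P))%MS.
    rewrite -(mxrank_leqif_sup (row_sub _ _)) rNP.
    by rewrite eqn_leq lt0n mxrank_eq0 uN rank_leq_row.
  by apply: submx_trans rowN _; rewrite rowE submxMr.
have mU : mxmodule R (kermx f).
  apply/mxmoduleP=> x Gx; apply/sub_kermxP.
  by rewrite -mulmxA hf // mulmxA mulmx_ker mul0mx.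
have [rN rE] := rank_submod_op mU.
set K := Representation _ in rN rE.
have rf : \rank f = 4 by apply: etrans (eqP full) dP.
have fN : prank f = 1.
  by rewrite /prank /nrank (eqmxMfull _ full) -/(opN a b P).
have [h1 h2 h3] := vfree_hom_ranks fR hf.
have [k1 k2 k3 k4 k5] := vstable_ranks (vstable_ker hf).
have rNR : \rank (opN a b R) = 3.
  by have := etrans (esym fR) dR; move: (\rank _) => r; lia.
have rU : \rank (kermx f) = 8 by rewrite mxrank_ker rf -[rdegree _]/(#|G|) (tet_card tetG).
exists K.
  have rK := rdegree_ge_opN tetG K.
  apply/eqP; rewrite eqn_leq rK andbT; apply: leq_trans (_ : 4 * 2 <= _)%N.
    exact: eq_leq rU.
  rewrite leq_pmul2l // rN -/(prank (kermx f)).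
  have arith kU pU : (1 + kU = 3 -> 8 <= 3 * kU + pU -> 2 <= pU)%N by lia.
  by rewrite fN rNR in h2; rewrite rU in k3; apply: arith h2 k3.
have := rank_idem_hom (avg_idem (rep_ccc tetG R)) (hom_opE tetG hf).
rewrite (eqmxMfull _ full) -rE -/(opE c R) => rER.
have psiRE : 3%:Z * (\rank (opE c R))%:Z - 12%:Z = 0 by rewrite -(congr1 Posz dR).
have psiPE : 3%:Z * (\rank (opE c P))%:Z - 4%:Z = 2 by rewrite -(congr1 Posz dP).
have -> : psi c K = 3%:Z * (\rank (opE c K))%:Z - 8%:Z by rewrite -(congr1 Posz rU).
move: rER psiRE psiPE.
by move: (\rank (opE c R)) (\rank (opE c P)) (\rank (opE c K)) => x y z; lia.
Qed.

End VfreeHom.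

(** * The projective cover of the trivial module *)

Section PermModule.

Local Open Scope ring_scope.

Notation A4 := ('Alt_('I_4))%G.
Variables (a b c : {perm 'I_4}).
Hypothesis tetG : tetrahedral A4 a b c.
Hypotheses (a0 : a ord0 != ord0) (b0 : b ord0 != ord0).
Hypothesis ab0 : (a * b)%g ord0 != ord0.

Lemma perm_mx_repr : mx_repr A4 (fun x : {perm 'I_4} => perm_mx x : 'M['F_2]_4).
Proof. by split=> [|x y _ _]; rewrite ?perm_mx1 ?perm_mxM. Qed.

Definition perm_module := Representation (MxRepresentation perm_mx_repr).

(** The norm of [V] maps the first basis vector to the sum of all four, so it has
    rank one.  The invariants of [c] then have dimension one or two by
    [rank_opE_vfree], and parity decides. *)
Lemma perm_module_vfree : vfree a b perm_module /\ psi c perm_module = 2.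
Proof.
have nz : opN a b perm_module != 0.
  apply/eqP=> /matrixP/(_ ord0 ord0).
  rewrite /opN /opX /opY /= mulmxDl mul1mx mulmxDr mulmx1 -perm_mxM !mxE /=.
  by rewrite (negPf a0) (negPf b0) (negPf ab0) !addr0 => /eqP; rewrite oner_eq0.
have fP : vfree a b perm_module.
  have rP := rdegree_ge_opN tetG perm_module.
  apply/eqP; rewrite eqn_leq rP andbT -{1}[rdegree _]/(4 * 1)%N leq_pmul2l //.
  by rewrite lt0n mxrank_eq0.
have rN : \rank (opN a b perm_module) = 1.
  by have := fP; rewrite /vfree /=; move: (\rank _) => r; lia.
split=> //; have rE := rank_opE_vfree tetG fP.
have [k] := rank_opE_parity tetG perm_module.
have := mxrankM_maxl (opN a b perm_module) (opE c perm_module).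
rewrite /psi rE rN -[rdegree _]/4%N; move: (\rank _) => r; lia.
Qed.

End PermModule.

(** * Homotopy invariance *)

Section TwoDimensional.

Local Open Scope ring_scope.

(** The invariants of the Klein four-group are non-zero and stable under [C].  As
    [C] has no non-zero fixed vector, they have even dimension, so they are
    everything. *)
Lemma tet_dim2 (n : nat) (A B C X Y : 'M['F_2]_n) :
    A *m A = 1%:M -> B *m B = 1%:M -> A *m B = B *m A ->
    A *m C = C *m B -> B *m C = C *m (A *m B) -> C *m C *m C = 1%:M ->
    X = 1%:M + A -> Y = 1%:M + B -> n = 2 -> 1%:M + C + C *m C = 0 ->
  X = 0 /\ Y = 0.
Proof.
move=> AA BB AB AC BC CCC XE YE n2 E0.
have XX := tetXX AA XE; have YY := tetYY BB YE; have XY := tetXY AB XE YE.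
have le1 := @rank_le_frank _ _ _ _ XX YY XY _ 1%:M (submx1 _) (submx1 _).
have le2 := @nrank_le_frank _ _ _ _ XX YY XY _ 1%:M (submx1 _) (submx1 _).
rewrite /frank cap1mx mxrank1 in le1 le2.
set K := kfix X Y in le1 le2.
have KX : K *m X = 0 by apply/sub_kermxP/capmxSl.
have KY : K *m Y = 0 by apply/sub_kermxP/capmxSr.
have KC : (K *m C <= K)%MS.
  have CAe : C *m A = A *m B *m C.
    by rewrite -mulmxA BC mulmxA AC -mulmxA (mulmxA B) -AB -mulmxA BB mulmx1.
  have KA : K *m A = K.
    by apply/eqP; rewrite -subr_eq0 oppmx2 addrC -{1}[K]mulmx1 -mulmxDr -XE KX.
  have KB : K *m B = K.
    by apply/eqP; rewrite -subr_eq0 oppmx2 addrC -{1}[K]mulmx1 -mulmxDr -YE KY.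
  rewrite sub_capmx; apply/andP; split; apply/sub_kermxP.
    by rewrite XE mulmxDr mulmx1 -mulmxA CAe !mulmxA KA KB addmm2.
  by rewrite YE mulmxDr mulmx1 -mulmxA -AC mulmxA KA addmm2.
have KE : K *m (1%:M + C + C *m C) = 0 by rewrite E0 mulmx0.
have [k [w [_ rK]]] := stable_pairs CCC KC KE.
have K1 : (1%:M <= K)%MS.
  by rewrite sub1mx -col_leq_rank; move: le1 le2 (rank_leq_col K); lia.
split; [rewrite -[X]mul1mx | rewrite -[Y]mul1mx]; apply/sub_kermxP.
  exact: submx_trans K1 (capmxSl _ _).
exact: submx_trans K1 (capmxSr _ _).
Qed.

(** The map induced by [f] from [Zc Ec / Bc Ec] to [Zd Ed / Bd Ed] is injective,
    when the idempotents [Ec] and [Ed] are compatible with [f]. *)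
Lemma homotopy_rank (F : fieldType) m n (Zc Bc Ec : 'M[F]_m) (Zd Bd Ed : 'M[F]_n)
    (f : 'M[F]_(m, n)) :
    Ec *m Ec = Ec -> Ec *m f = f *m Ed -> (Zc *m Ec <= Zc)%MS ->
    (Bd *m Ed <= Bd)%MS -> (Bd <= Zd)%MS -> (Zc *m f <= Zd)%MS ->
    (forall k (v : 'M_(k, m)), v <= Zc -> v *m f <= Bd -> v <= Bc)%MS ->
  (\rank (Zc *m Ec) + \rank (Bd *m Ed) <= \rank (Zd *m Ed) + \rank (Bc *m Ec))%N.
Proof.
move=> EE Ef ZE BE BZ Zf ker_f; pose q := cokermx (Bd *m Ed).
have r1 := mxrank_mul_ker (Zc *m Ec) (f *m q).
have r2 := mxrank_mul_ker (Zd *m Ed) q.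
set K := (Zc *m Ec :&: _)%MS in r1.
have K_E : K = K *m Ec.
  have /submxP[W KW] : (K <= Zc *m Ec)%MS by apply: capmxSl.
  by rewrite KW -!mulmxA EE.
have KB : (K <= Bc *m Ec)%MS.
  rewrite K_E submxMr // ker_f ?(submx_trans (capmxSl _ _) ZE) //.
  apply: submx_trans BE; rewrite submxE -mulmxA; apply/eqP/sub_kermxP.
  exact: capmxSr.
have le1 : (\rank (Zc *m Ec *m (f *m q)) <= \rank (Zd *m Ed *m q))%N.
  by rewrite mxrankS // mulmxA -(mulmxA Zc) Ef (mulmxA Zc) !submxMr.
have le2 : (\rank (Bd *m Ed) <= \rank (Zd *m Ed :&: kermx q)%MS)%N.
  rewrite mxrankS // sub_capmx submxMr //; apply/sub_kermxP.
  by apply/eqP; rewrite -submxE.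
by have := mxrankS KB; lia.
Qed.

End TwoDimensional.

Section Homotopy.

Local Open Scope ring_scope.

Variables (F : fieldType) (gT : finGroupType) (G : {group gT}).
Implicit Types C D : cochain_complex F G.

Lemma coboundariesS C i : (coboundaries C (i + 1) :=: cdiff C i (i + 1))%MS.
Proof. by rewrite /coboundaries addrK; apply: genmxE. Qed.

Lemma homotopy_cocycles C D (f : graded_map C D) (g : graded_map D C) :
    cochain_map f -> cochain_map g ->
    homotopic (fun i => f i *m g i : 'M_(rdegree (C i))) (fun i => 1%:M) ->
  forall i, (coboundaries D i *m g i <= coboundaries C i)%MS /\
    (cocycles C i *m f i <= cocycles D i)%MS /\
    (forall k (v : 'M_(k, _)), v <= cocycles C i ->
       v *m f i <= coboundaries D i -> v <= coboundaries C i)%MS.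
Proof.
move=> [_ fd] [_ gd] [h _ hh] i.
have Bg : (coboundaries D i *m g i <= coboundaries C i)%MS.
  rewrite !genmxE (eqmxMr _ (genmxE _)) gd; exact: submxMl.
split=> //; split.
  by apply/sub_kermxP; rewrite -mulmxA -fd mulmxA mulmx_ker mul0mx.
move=> k v vZ vf; have := congr1 (mulmx v) (hh i).
rewrite mulmxBr mulmx1 mulmxDr [v *m (cdiff _ _ _ *m _)]mulmxA.
rewrite (sub_kermxP vZ) mul0mx addr0 => e.
have -> : v = v *m (f i *m g i) - v *m (h i (i - 1) *m cdiff C (i - 1) i).
  by rewrite -e opprB addrC subrK.
rewrite addmx_sub ?eqmx_opp //.
  by rewrite mulmxA (submx_trans _ Bg) // submxMr.
by rewrite genmxE mulmxA submxMl.
Qed.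

End Homotopy.

(** * Euler characteristics *)

Section Euler.

Local Open Scope ring_scope.

(** The sign is positive in degree [-B]. *)
Definition alt (B : nat) (f : int -> int) : int :=
  \sum_(k < (2 * B).+1) (-1) ^+ k * f (k%:Z - B%:Z).

Lemma alt_telescope n (g : nat -> int) :
  \sum_(k < n) (-1) ^+ k * (g k + g k.+1) = g 0 - (-1) ^+ n * g n.
Proof.
elim: n => [|n IHn]; first by rewrite big_ord0 expr0 mul1r subrr.
rewrite big_ord_recr /= IHn mulrDr exprS !mulN1r mulNr opprK addrA.
by rewrite subrK.
Qed.

Lemma eq_alt B (f g : int -> int) : f =1 g -> alt B f = alt B g.
Proof. by move=> fg; apply: eq_bigr => k _; rewrite fg. Qed.

(** [h i] is to be the invariant of the coboundaries in degree [i]: then [f] and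
    [g] are those of the cochains and of the cohomology. *)
Lemma alt_telescoping B (f g h : int -> int) :
    (forall i, f i = g i + (h i + h (i + 1))) -> h (- B%:Z) = 0 ->
    h (B%:Z + 1) = 0 -> alt B f = alt B g.
Proof.
move=> fE h0 hB; rewrite /alt.
under eq_bigr => k _ do rewrite fE mulrDr.
rewrite big_split /= -[RHS]addr0; congr (_ + _).
pose g' (k : nat) := h (k%:Z - B%:Z).
rewrite (eq_bigr (fun k : 'I__ => (-1) ^+ k * (g' k + g' k.+1))) => [|k _].
  have e : (2 * B).+1%:Z - B%:Z = B%:Z + 1 by lia.
  by rewrite alt_telescope /g' sub0r h0 e hB mulr0 subrr.
by rewrite /g'; congr (_ * (_ + h _)); lia.
Qed.

Lemma altZ B (x : int) f : alt B (fun i => x * f i) = x * alt B f.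
Proof. by rewrite /alt big_distrr; apply: eq_bigr => k _; rewrite mulrCA. Qed.

Lemma altB B f g : alt B (fun i => f i - g i) = alt B f - alt B g.
Proof.
by rewrite /alt -sumrB; apply: eq_bigr => k _; rewrite mulrBr.
Qed.

Lemma alt_single B (x : nat) (f : int -> int) : (x <= B)%N ->
  (forall i, i != x%:Z -> f i = 0) -> alt B f = (-1) ^+ (x + B)%N * f x%:Z.
Proof.
move=> xB f0; have lt_x : (x + B < (2 * B).+1)%N by lia.
rewrite /alt (bigD1 (Ordinal lt_x)) //= big1 => [|k nk].
  by rewrite addr0; congr (_ * f _); lia.
by rewrite f0 ?mulr0 //; apply: contra nk; rewrite -val_eqE /=; lia.
Qed.

Lemma alt_count B (s : seq nat) : all (fun x => x <= B)%N s ->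
  alt B (fun i => (count_mem i [seq x%:Z | x <- s])%:Z)
    = (-1) ^+ B * \sum_(x <- s) (-1) ^+ x.
Proof.
elim: s => [|x s IHs] /= => [_|/andP[xB /IHs {}IHs]].
  by rewrite big_nil mulr0 /alt big1 // => k _; rewrite mulr0.
rewrite big_cons mulrDr -IHs -exprD addnC.
have -> : (-1) ^+ (x + B)%N = alt B (fun i => (i == x%:Z)%:Z).
  rewrite (@alt_single B x) // ?eqxx ?mulr1 // => i.
  by case: eqP.
rewrite /alt -big_split /=; apply: eq_bigr => k _.
by rewrite -mulrDr PoszD eq_sym.
Qed.

End Euler.

Section ComplexEuler.

Local Open Scope ring_scope.

Variables (gT : finGroupType) (G : {group gT}) (a b c : gT).
Hypothesis tetG : tetrahedral G a b c.
Implicit Types C D : cochain_complex 'F_2 G.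

Lemma bounded_rank0 C i k (U : 'M['F_2]_(k, rdegree (C i))) :
  rdegree (C i) = 0%N -> \rank U = 0%N.
Proof. by move=> d0; apply/eqP; rewrite -leqn0; apply: leq_trans (eq_leq d0); apply: rank_leq_col. Qed.

Lemma euler_rdegree C d B :
    (forall i : int, (d < `|i|)%N -> rdegree (C i) = 0%N) -> (d < B)%N ->
  alt B (fun i => (rdegree (C i))%:Z)
    = alt B (fun i => (rdegree (cohomology C i))%:Z).
Proof.
move=> bC bB; pose h i := (\rank (coboundaries C i))%:Z.
apply: (@alt_telescoping B _ _ h) => [i||].
- have h1 := rank_cdiff C i; have h2 := rdegree_cohomology C i.
  have arith (dC dH rZ rB rB' : nat) : (rZ + rB' = dC)%N -> (dH + rB = rZ)%N ->
    dC%:Z = dH%:Z + (rB%:Z + rB'%:Z) by lia.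
  exact: arith h1 h2.
- by rewrite /h bounded_rank0 ?bC //; lia.
by rewrite /h bounded_rank0 ?bC //; lia.
Qed.

Lemma euler_psi C d B :
    (forall i : int, (d < `|i|)%N -> rdegree (C i) = 0%N) -> (d < B)%N ->
  alt B (fun i => psi c (C i)) = alt B (fun i => psi c (cohomology C i)).
Proof.
move=> bC bB.
pose h i := 3%:Z * (\rank (coboundaries C i *m opE c (C i)))%:Z
  - (\rank (coboundaries C i))%:Z.
have h0 i : rdegree (C i) = 0%N -> h i = 0.
  by move=> d0; rewrite /h !bounded_rank0 // mulr0 subrr.
apply: (@alt_telescoping B _ _ h) => [i||].
- have h1 := rank_cdiff C i; have h2 := rdegree_cohomology C i.
  have h3 := cohomology_opE tetG C i; have h4 := rank_opE_cdiff tetG C i.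
  have arith (dC dH eC eH rZ rB rB' eZ eB eB' : nat) :
      (rZ + rB' = dC)%N -> (dH + rB = rZ)%N -> (eH + eB = eZ)%N -> (eZ + eB' = eC)%N ->
      3%:Z * eC%:Z - dC%:Z = 3%:Z * eH%:Z - dH%:Z +
        (3%:Z * eB%:Z - rB%:Z + (3%:Z * eB'%:Z - rB'%:Z)).
    by lia.
  exact: arith h1 h2 h3 h4.
- by apply/h0/bC; lia.
by apply/h0/bC; lia.
Qed.

End ComplexEuler.

Section HomotopyPsi.

Local Open Scope ring_scope.

Variables (gT : finGroupType) (G : {group gT}) (a b c : gT).
Hypothesis tetG : tetrahedral G a b c.
Implicit Types C D : cochain_complex 'F_2 G.

Lemma homotopic_cohomology_le C D (f : graded_map C D) (g : graded_map D C) i :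
    cochain_map f -> cochain_map g ->
    homotopic (fun i => f i *m g i : 'M_(rdegree (C i))) (fun i => 1%:M) ->
  (rdegree (cohomology C i) <= rdegree (cohomology D i))%N /\
  (\rank (opE c (cohomology C i)) <= \rank (opE c (cohomology D i)))%N.
Proof.
move=> cf cg hfg; have [_ [Zf kf]] := homotopy_cocycles cf cg hfg i.
have [fh _] := cf.
have BZ := coboundaries_sub D i.
have mZ := cocycles_module C i; have mB := coboundaries_module D i.
have CCC := rep_ccc tetG (C i).
have h1 := rdegree_cohomology C i; have h2 := rdegree_cohomology D i.
have h3 := cohomology_opE tetG C i; have h4 := cohomology_opE tetG D i.
have arith (hC hD zC zD bC bD : nat) : (hC + bC = zC)%N -> (hD + bD = zD)%N ->
  (zC + bD <= zD + bC)%N -> (hC <= hD)%N by lia.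
split.
  have le1 := @homotopy_rank _ _ _ (cocycles C i) (coboundaries C i) 1%:M
    (cocycles D i) (coboundaries D i) 1%:M (f i).
  rewrite !mulmx1 !mul1mx in le1.
  exact: arith h1 h2 (le1 _ _ _ _ BZ Zf kf).
apply: arith h3 h4 _; apply: homotopy_rank BZ Zf kf.
- exact: avg_idem CCC.
- exact (hom_opE tetG (fh i)).
- exact (module_opE tetG mZ).
exact (module_opE tetG mB).
Qed.

Lemma psi_cohomology_homotopy C D : homotopy_equivalent C D ->
  forall i, psi c (cohomology C i) = psi c (cohomology D i).
Proof.
move=> [f [g [cf cg fg gf]]] i.
have [d1 e1] := homotopic_cohomology_le i cf cg fg.
have [d2 e2] := homotopic_cohomology_le i cg cf gf.
rewrite /psi; congr (3%:Z * Posz _ - Posz _); apply/eqP; rewrite eqn_leq.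
  by rewrite e1.
by rewrite d1.
Qed.

End HomotopyPsi.

(** * Excluding two non-trivial simple cohomology modules *)

Section TwoSimples.

Local Open Scope ring_scope.

Variables (gT : finGroupType) (G : {group gT}) (a b c : gT).
Hypothesis tetG : tetrahedral G a b c.
Variables (C : cochain_complex 'F_2 G) (d n : nat).
Hypothesis freeC : forall i, vfree a b (C i).
Hypothesis boundC : forall i : int, (d < `|i|)%N -> rdegree (C i) = 0%N.
Hypothesis n_gt0 : (0 < n)%N.
Hypothesis dim0 : forall i : int, i != 0 -> i != n%:Z ->
  rdegree (cohomology C i) = 0%N.
Hypothesis dim2 : forall i : int, i = 0 \/ i = n%:Z ->
  rdegree (cohomology C i) = 2%N /\ \rank (opE c (cohomology C i)) = 0%N.

Notation Z i := (cocycles C i).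
Notation B i := (coboundaries C i).
Notation vfr U := (\rank U = (4 * prank a b U)%N).
Notation krk U := (krank a b U).
Notation prk U := (prank a b U).

Lemma vstable_module i (U : 'M_(rdegree (C i))) : mxmodule (C i) U -> vstable a b U.
Proof.
by move=> mU; split; [exact (module_opX tetG mU) | exact (module_opY tetG mU)].
Qed.

Lemma vrank_eqmx (M : representation 'F_2 G) k l (U : 'M_(k, rdegree M))
    (V : 'M_(l, rdegree M)) : (U :=: V)%MS ->
  [/\ \rank U = \rank V, prk U = prk V & krk U = krk V].
Proof.
move=> UV; split; first by rewrite UV.
  by rewrite /prank /nrank (eqmxMr _ UV).
by rewrite /krank /frank (cap_eqmx UV (eqmx_refl _)).
Qed.

Lemma exact_cohomology i : i != 0 -> i != n%:Z -> (B i :=: Z i)%MS.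
Proof.
move=> i0 iN; have h := rdegree_cohomology C i; rewrite dim0 // add0n in h.
have s := coboundaries_sub C i; apply/eqmxP.
by rewrite s /= -(mxrank_leqif_sup s) h eqxx.
Qed.

Lemma free_step i : vfr (Z i) <-> vfr (B (i + 1)).
Proof.
have hd : module_hom (cdiff C i (i + 1)) by apply: cdiff_hom.
have [r1 r2 _] := vrank_eqmx (coboundariesS C i).
by rewrite r1 r2; apply: iff_sym (ker_free_iff tetG (freeC i) hd).
Qed.

Lemma phi_step i : (2 * krk (Z i) + 2 * prk (Z i) + \rank (B (i + 1)%R)
   <= 2 * krk (B (i + 1)) + 2 * prk (B (i + 1)) + \rank (Z i))%N.
Proof.
have hd : module_hom (cdiff C i (i + 1)) by apply: cdiff_hom.
have [r1 r2 r3] := vrank_eqmx (coboundariesS C i).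
by rewrite r1 r2 r3; apply: (phi_image tetG (freeC i) hd).
Qed.

Lemma free_zero i (U : 'M_(rdegree (C i))) : (d < `|i|)%N -> vfr U.
Proof.
move=> /boundC d0; rewrite (bounded_rank0 _ d0) /prank /nrank.
by rewrite (bounded_rank0 _ d0) muln0.
Qed.

(** Below degree 0 the complex is exact and starts with 0, so its coboundaries are
    free up to degree 0. *)
Lemma free_left k : (k <= d.+1)%N -> vfr (B (k%:Z - d.+1%:Z)).
Proof.
elim: k => [|k IHk] lek; first by apply: free_zero; lia.
have -> : k.+1%:Z - d.+1%:Z = (k%:Z - d.+1%:Z) + 1 by lia.
have [||r1 r2 _] := vrank_eqmx (@exact_cohomology (k%:Z - d.+1%:Z) _ _).
- by apply/eqP; lia.
- by apply/eqP; lia.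
by apply/free_step; rewrite -r1 -r2; apply: IHk; lia.
Qed.

(** Above degree [n] the complex is exact and ends with 0, so its cocycles are
    free down to degree [n]. *)
Lemma free_right k : (n + k <= d.+1)%N -> vfr (Z (d.+1%:Z - k%:Z)).
Proof.
elim: k => [|k IHk] lek; first by apply: free_zero; lia.
apply/free_step; have -> : d.+1%:Z - k.+1%:Z + 1 = d.+1%:Z - k%:Z by lia.
have [||r1 r2 _] := vrank_eqmx (@exact_cohomology (d.+1%:Z - k%:Z) _ _).
- by apply/eqP; lia.
- by apply/eqP; lia.
by rewrite r1 r2; apply: IHk; lia.
Qed.

Lemma trivial_action i : i = 0 \/ i = n%:Z ->
  [/\ (Z i *m opX a (C i) <= B i)%MS, (Z i *m opY b (C i) <= B i)%MS
    & \rank (Z i) = (\rank (B i) + 2)%N].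
Proof.
case/dim2=> dH rE; set H := cohomology C i in dH rE.
have [X0 Y0] := tet_dim2 (rep_aa tetG H) (rep_bb tetG H) (rep_ab tetG H)
  (rep_ac tetG H) (rep_bc tetG H) (rep_ccc tetG H) (erefl (opX a H))
  (erefl (opY b H)) dH (eqP (etrans (esym (mxrank_eq0 (opE c H))) (introT eqP rE))).
have sub (U : 'M['F_2]_(rdegree (C i))) :
    (0 + \rank (B i))%N = \rank (U + B i)%MS -> (U <= B i)%MS.
  rewrite add0n => r; have s := addsmxSr U (B i).
  apply: submx_trans (addsmxSl U (B i)) _.
  by rewrite -(mxrank_leqif_sup s) -r eqxx.
have r0 : \rank (0 : 'M['F_2]_(rdegree H)) = 0%N by rewrite mxrank0.
split.
- by apply: sub; rewrite -(cohomology_opX tetG) X0 r0.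
- by apply: sub; rewrite -(cohomology_opY tetG) Y0 r0.
by rewrite -(rdegree_cohomology C i) addnC; congr addn.
Qed.

(** The cocycles in degree 0 are an extension of a trivial plane by a free module;
    the extension splits, and [phi] is at least 2. *)
Lemma phi_B0 : (\rank (Z 0) + 2 <= 2 * krk (Z 0) + 2 * prk (Z 0))%N.
Proof.
have [ZX ZY rZ] := trivial_action (or_introl (erefl 0)).
have fB : vfr (B 0) by have := free_left (leqnn _); rewrite subrr.
have [k1 k2 k3 _ _] := vstable_ranks tetG (vstable_module (coboundaries_module C 0)).
have [UX UY] := vstable_module (coboundaries_module C 0).
have XX := opXX tetG (C 0); have YY := opYY tetG (C 0).
have XY := opXY tetG (C 0).
have lZ := @rank_trivial_ext _ _ _ _ XX YY XY _ (B 0) UX UY _ (Z 0) ZX ZY.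
have lP : (prk (B 0) <= prk (Z 0))%N.
  by rewrite mxrankS // submxMr // coboundaries_sub.
have arith (x y u v z w : nat) : (x = y + 2 -> y = 4 * v -> v <= u ->
  3 * v + u <= y -> x <= 3 * u + z -> v <= w ->
  x + 2 <= 2 * z + 2 * w)%N by lia.
exact: arith rZ fB k1 k2 lZ lP.
Qed.

(** Each further coboundary module is a cosyzygy of the previous one. *)
Lemma phi_B k : (k < n)%N ->
  (\rank (B k.+1%:Z) + 2 <= 2 * krk (B k.+1%:Z) + 2 * prk (B k.+1%:Z))%N.
Proof.
have arith (rZ kZ pZ rB kB pB : nat) : (rZ + 2 <= 2 * kZ + 2 * pZ ->
  2 * kZ + 2 * pZ + rB <= 2 * kB + 2 * pB + rZ ->
  rB + 2 <= 2 * kB + 2 * pB)%N by lia.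
elim: k => [|k IHk] kn.
  by have -> : 1%:Z = 0 + 1 :> int by []; apply: arith phi_B0 (phi_step 0).
have -> : k.+2%:Z = k.+1%:Z + 1 by lia.
apply: arith (phi_step k.+1%:Z).
have [||r1 r2 r3] := vrank_eqmx (@exact_cohomology k.+1%:Z _ _).
- by apply/eqP; lia.
- by apply/eqP; lia.
by rewrite -r1 -r2 -r3; apply: IHk; lia.
Qed.

(** The complex would make the [n]-th cosyzygy of a trivial plane stably
    isomorphic over [V] to its first syzygy, the coboundaries in degree [n].  But
    [phi] is at least 2 on the former and at most -2 on the latter. *)
Lemma no_two_simples : False.
Proof.
have n_le : (n <= d.+1)%N.
  rewrite leqNgt; apply/negP=> lt_n.
  have [d2 _] := dim2 (or_intror (erefl n%:Z)).
  have h := rdegree_cohomology C n%:Z.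
  have d0 : rdegree (C n%:Z) = 0%N by apply: boundC; lia.
  by rewrite d2 (bounded_rank0 (Z n%:Z) d0) in h.
have [ZX ZY rZ] := trivial_action (or_intror (erefl n%:Z)).
have fZ : vfr (Z n%:Z).
  have := @free_right (d.+1 - n)%N; have -> : d.+1%:Z - (d.+1 - n)%N%:Z = n%:Z by lia.
  by apply; lia.
have [k1 k2 k3 k4 _] := vstable_ranks tetG (vstable_module (cocycles_module C n%:Z)).
have XX := opXX tetG (C n%:Z); have YY := opYY tetG (C n%:Z).
have XY := opXY tetG (C n%:Z).
have jB := krad_nrank_sub XX YY XY ZX ZY.
have kB : (krk (B n%:Z) <= krk (Z n%:Z))%N.
  by rewrite mxrankS // capmxS // coboundaries_sub.
have pB : (\rank (B n%:Z) + 2 <= 2 * krk (B n%:Z) + 2 * prk (B n%:Z))%N.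
  by have := @phi_B n.-1; rewrite prednK //; apply.
have arith (x y u v z w j : nat) : (x = y + 2 -> x = 4 * w ->
  3 * w + z <= x -> 3 * w <= j -> v + j <= y -> u <= z ->
  y + 2 <= 2 * u + 2 * v -> False)%N by lia.
exact: arith rZ fZ k2 k4 jB kB pB.
Qed.

End TwoSimples.

(** * Replacing a perfect complex by a free one *)

Section Elementary.

Local Open Scope ring_scope.

Variables (F : fieldType) (gT : finGroupType) (G : {group gT}).
Variables (C : cochain_complex F G) (K : int -> representation F G).

(** The identity of [K i] when [i = l], typed for all pairs of degrees. *)
Definition degree_id i l : 'M[F]_(rdegree (K i), rdegree (K l)) :=
  if i == l then pid_mx (rdegree (K i)) else 0.

Lemma degree_id_hom i l : module_hom (degree_id i l).
Proof.
move=> x Gx; rewrite /degree_id; case: eqP => [<-|_].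
  by rewrite pid_mx_1 mulmx1 mul1mx.
by rewrite mulmx0 mul0mx.
Qed.

Lemma degree_idK i l : i = l -> degree_id i l *m degree_id l i = 1%:M.
Proof. by move=> <-; rewrite /degree_id eqxx pid_mx_1 mulmx1. Qed.

(** The direct sum of [C] and of the contractible complexes with two terms
    [K i -> K i] in degrees [i] and [i + 1]. *)
Definition elementary_obj i : representation F G :=
  dadd_grepr (C i) (dadd_grepr (K i) (K (i - 1))).

Definition elementary_diff i j :
    'M[F]_(rdegree (elementary_obj i), rdegree (elementary_obj j)) :=
  block_mx (cdiff C i j) 0 0 (block_mx 0 (degree_id i (j - 1)) 0 0).

Lemma elementary_hom i j : module_hom (elementary_diff i j).
Proof.
move=> x Gx; rewrite /= /elementary_diff.
rewrite !(mulmx_block, mulmx0, mul0mx, addr0, add0r) cdiff_hom //.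
by rewrite degree_id_hom.
Qed.

Lemma elementary_shape i j : j != i + 1 -> elementary_diff i j = 0.
Proof.
move=> nij; rewrite /elementary_diff cdiff_shape // /degree_id.
have -> : (i == j - 1) = false.
  by apply: contraNF nij => /eqP->; rewrite subrK.
by rewrite !block_mx0.
Qed.

Lemma elementary_sq0 i j k : elementary_diff i j *m elementary_diff j k = 0.
Proof.
rewrite /elementary_diff !(mulmx_block, mulmx0, mul0mx, addr0, add0r).
by rewrite cdiff_sq0 !block_mx0.
Qed.

Definition elementary_complex : cochain_complex F G :=
  CochainComplex elementary_hom elementary_shape elementary_sq0.

Lemma elementary_equivalence : homotopy_equivalent C elementary_complex.
Proof.
pose f : graded_map C elementary_complex := fun i => row_mx 1%:M 0.
pose g : graded_map elementary_complex C := fun i => col_mx 1%:M 0.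
pose h i j : 'M[F]_(rdegree (elementary_complex i), rdegree (elementary_complex j)) :=
  block_mx 0 0 0 (block_mx 0 0 (- degree_id (i - 1) j) 0).
exists f, g; split.
- split=> [i x Gx|i j]; rewrite /f /= /elementary_diff mul_mx_row mul_row_block;
    by rewrite !(mulmx0, mul0mx, addr0, add0r, mulmx1, mul1mx).
- split=> [i x Gx|i j]; rewrite /g /= /elementary_diff mul_block_col [RHS]mul_col_mx;
    by rewrite !(mulmx0, mul0mx, addr0, add0r, mulmx1, mul1mx).
- exists (fun i j => 0) => [i j x Gx|i]; first by rewrite mulmx0 mul0mx.
  by rewrite mul_row_col mulmx1 mulmx0 addr0 subrr mul0mx mulmx0 addr0.
exists h => [i j x Gx|i].
  rewrite /h /= !(mulmx_block, mulmx0, mul0mx, addr0, add0r) mulmxN mulNmx.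
  by rewrite degree_id_hom.
rewrite /f /g /h /= /elementary_diff mul_col_row.
rewrite !(mulmx_block, mulmx0, mul0mx, addr0, add0r, mulmx1).
rewrite mulNmx mulmxN !degree_idK ?addrK //.
rewrite !scalar_mx_block !opp_block_mx !add_block_mx !(addr0, add0r).
by rewrite subrr !oppr0.
Qed.

End Elementary.

Section Primitive.

Local Open Scope ring_scope.

(** The partial alternating sums of [p]; they vanish from degree [B] on because
    the total sum does. *)
Lemma alternating_primitive (B : nat) (p : int -> int) :
    (forall i : int, (B < `|i|)%N -> p i = 0) -> alt B p = 0 ->
  exists2 z : int -> int, forall i, z i + z (i - 1) = - p i
    & forall i : int, (B < `|i|)%N -> z i = 0.
Proof.
move=> p0 altp; pose y n : int :=
  (-1) ^+ n * \sum_(k < n) (-1) ^+ k * p (k%:Z - B%:Z).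
have yS n : y n.+1 = - p (n%:Z - B%:Z) - y n.
  rewrite /y big_ord_recr /= exprS mulN1r mulNr mulrDr mulrA -expr2.
  by rewrite sqrr_sign mul1r opprD addrC.
have y0 : y 0%N = 0 by rewrite /y big_ord0 mulr0.
have y_big k : y ((2 * B).+1 + k)%N = 0.
  elim: k => [|k IHk]; first by rewrite addn0 /y -[\sum_(_ < _) _]/(alt B p) altp mulr0.
  by rewrite addnS yS IHk p0 ?oppr0 ?addr0 //; lia.
exists (fun i : int => if i < - B%:Z then 0 else y (absz (i + B%:Z + 1)%R)) => [i|i Bi].
  case: ltP => iB; case: ltP => iB'.
  - by rewrite p0 ?addr0 ?oppr0 //; lia.
  - by lia.
  - have -> : i = - B%:Z by lia.
    have -> : (absz (- B%:Z + B%:Z + 1)%R) = 1%N by lia.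
    by rewrite yS y0 subr0 addr0 sub0r.
  have -> : (absz (i + B%:Z + 1)%R) = (absz (i - 1 + B%:Z + 1)%R).+1 by lia.
  rewrite yS subrK; congr (- p _); lia.
case: ltP => // iB; have -> : (absz (i + B%:Z + 1)%R) = ((2 * B).+1 + `|i - B%:Z|)%N by lia.
exact: y_big.
Qed.

End Primitive.

Section FreeReplacement.

Local Open Scope ring_scope.

Variables (gT : finGroupType) (G : {group gT}) (a b c : gT).
Hypothesis tetG : tetrahedral G a b c.

Notation rep := (representation 'F_2 G).

Lemma psi_even (M : rep) : exists p : int, psi c M = 2%:Z * p.
Proof.
have [k rM] := rank_opE_parity tetG M.
exists ((\rank (opE c M))%:Z - k%:Z).
have arith (r d : nat) : d = (r + 2 * k)%N ->
  3%:Z * r%:Z - d%:Z = 2%:Z * (r%:Z - k%:Z) by lia.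
exact: arith rM.
Qed.

Variables P Q : rep.
Hypotheses (fP : vfree a b P) (fQ : vfree a b Q).
Hypotheses (psiP : psi c P = 2) (psiQ : psi c Q = - 2%:Z).

(** [psi] has opposite values on [P] and [Q], so negative [x] call for [Q]. *)
Definition correction (x : int) : rep :=
  match x with
  | Posz n => muln_grepr P n
  | Negz n => muln_grepr Q n.+1
  end.

Lemma correction_vfree x : vfree a b (correction x).
Proof. by case: x => n; apply: (vfree_muln tetG). Qed.

Lemma correction_psi x : psi c (correction x) = 2%:Z * x.
Proof.
case: x => n; rewrite /correction psi_muln ?psiP ?psiQ.
  by rewrite -[LHS]mulr_natr !natz.
by rewrite -[LHS]mulr_natr !natz NegzE mulrN mulNr.
Qed.

Lemma rdegree_correction0 : rdegree (correction 0) = 0%N.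
Proof. exact: (congr1 (fun M : rep => rdegree M) (muln_grepr0 P)). Qed.

(** The corrections [K i] are chosen so that [psi] vanishes on every
    [C i + K i + K (i - 1)]; there are finitely many non-zero ones because the
    Euler characteristic of [psi] vanishes. *)
Lemma free_replacement (C : cochain_complex 'F_2 G) (B : nat) :
    (forall i, vfree a b (C i)) ->
    (forall i : int, (B < `|i|)%N -> rdegree (C i) = 0%N) ->
    alt B (fun i => psi c (C i)) = 0 ->
  exists D : cochain_complex 'F_2 G, finite_free D /\ homotopy_equivalent C D.
Proof.
move=> fC bC alt0; pose p i := (psi c (C i) %/ 2)%Z.
have pE i : psi c (C i) = 2%:Z * p i.
  by rewrite /p; have [q ->] := psi_even (C i); rewrite mulKz.
have p0 i : (B < `|i|)%N -> p i = 0.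
  by move=> /bC d0; rewrite /p /psi (bounded_rank0 _ d0) d0.
have altp : alt B p = 0.
  have : 2%:Z * alt B p = 0 by rewrite -altZ -[RHS]alt0; apply: eq_alt => i; rewrite pE.
  lia.
have [z zE z0] := alternating_primitive p0 altp.
pose D := elementary_complex C (fun i => correction (z i)).
exists D; split; last exact: elementary_equivalence.
split=> [|i].
  exists B.+1 => i Bi; rewrite /= bC 1?ltnW // !z0 ?rdegree_correction0 //; lia.
apply: (vfree_psi0_free tetG).
  apply/(vfree_dadd tetG); split; first exact: fC.
  by apply/(vfree_dadd tetG); split; apply: correction_vfree.
rewrite !psi_dadd !correction_psi pE -mulrDr.
by rewrite -mulrDr zE subrr mulr0.
Qed.

End FreeReplacement.

(** * Possible degrees of the cohomology *)

Section Degrees.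

Local Open Scope ring_scope.

(** [w i] will be the multiplicity of the two-dimensional simple module in the
    cohomology of degree [i]. *)
Variables (m n t B : nat) (w : int -> nat).
Hypotheses (le_mn : (m <= n)%N) (le_nt : (n <= t)%N) (tB : (t <= B)%N).

Let betti (i : int) : nat := count_mem i [:: 0%:Z; m%:Z; n%:Z; t%:Z].

Let all_le : all (fun x => x <= B)%N [:: 0%N; m; n; t].
Proof. by rewrite /= tB; lia. Qed.

Lemma alt_betti : alt B (fun i => (betti i)%:Z) =
  (-1) ^+ B * (1 + (-1) ^+ m + (-1) ^+ n + (-1) ^+ t).
Proof.
by rewrite (alt_count all_le) !big_cons big_nil expr0 addr0 !addrA.
Qed.

Lemma sign_cases k : (-1) ^+ k = (if odd k then -1 else 1) :> int.
Proof. by rewrite -signr_odd; case: odd. Qed.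

(** A sum of four signs that is divisible by four vanishes unless all four signs
    agree, and it cannot vanish when three of them agree. *)
Lemma alt_betti_odd : (exists q : int, alt B (fun i => (betti i)%:Z) = 4%:Z * q) ->
  (odd m \/ odd n) <-> alt B (fun i => (betti i)%:Z) = 0.
Proof.
rewrite alt_betti !sign_cases.
by case: (odd m); case: (odd n); case: (odd t); case: (odd B);
  move=> [q e]; split=> // h; try (by left); try (by right); move: e h; lia.
Qed.

Hypothesis w_le : forall i, (2 * w i <= betti i)%N.

Lemma sum_betti : (\sum_(k < (2 * B).+1) betti (k%:Z - B%:Z)%R <= 4)%N.
Proof.
have sum1 (x : nat) : (\sum_(k < (2 * B).+1) (x%:Z == k%:Z - B%:Z)%R <= 1)%N.
  have [k0|none] := pickP (fun k : 'I_(2 * B).+1 => x%:Z == k%:Z - B%:Z).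
    move=> /eqP k0E; rewrite (bigD1 k0) //= big1 => [|k nk].
      by rewrite addn0 leq_b1.
    by apply/eqP; rewrite eqb0; apply: contra nk; rewrite -val_eqE /=; lia.
  by rewrite big1 // => k _; have := none k => /= ->.
have e : \sum_(k < (2 * B).+1) betti (k%:Z - B%:Z)%R =
   (\sum_(k < (2 * B).+1) (0%:Z == k%:Z - B%:Z)%R +
   (\sum_(k < (2 * B).+1) (m%:Z == k%:Z - B%:Z)%R +
   (\sum_(k < (2 * B).+1) (n%:Z == k%:Z - B%:Z)%R +
   (\sum_(k < (2 * B).+1) (t%:Z == k%:Z - B%:Z)%R))))%N.
  by rewrite -!big_split /=; apply: eq_bigr => k _; rewrite /betti /= addn0.
by rewrite e; have := sum1 0%N; have := sum1 m; have := sum1 n; have := sum1 t; lia.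
Qed.

Lemma alt_le f : (forall i, (2 * f i <= betti i)%N) ->
  `|alt B (fun i => (f i)%:Z)| <= 2.
Proof.
move=> f_le; apply: le_trans (ler_norm_sum _ _ _) _.
rewrite (eq_bigr (fun k : 'I__ => (f (k%:Z - B%:Z))%:Z)) => [|k _]; last first.
  by rewrite normrM normrX normrN1 expr1n mul1r.
rewrite -(big_morph Posz PoszD (erefl 0%:Z)) lez_nat.
have : (2 * \sum_(k < (2 * B).+1) f (k%:Z - B%:Z)%R <= 4)%N.
  apply: leq_trans sum_betti; rewrite big_distrr /=.
  by apply: leq_sum => k _; apply: f_le.
by move=> h; rewrite -(leq_pmul2l (isT : 0 < 2)%N).
Qed.

Lemma sorted_double x :
    (2 <= (0 == x) + ((m == x) + ((n == x) + ((t == x) + 0))))%N ->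
  (0 = x /\ m = x \/ m = x /\ n = x \/ n = x /\ t = x)%N.
Proof. by do 4![case: eqP] => //=; lia. Qed.

(** The alternating sum of [w] is at most 2 in absolute value, and three times it
    is divisible by 4; so it vanishes.  If some [w i] is not zero, then so is
    another one of the opposite sign, and the two use up all four dimensions. *)
Lemma simple_degrees (q : int) :
    alt B (fun i => (betti i)%:Z) = 4%:Z * q ->
    2%:Z * alt B (fun i => (betti i)%:Z) = 6%:Z * alt B (fun i => (w i)%:Z) ->
  alt B (fun i => (betti i)%:Z) = 0 /\
  ((forall i, w i = 0%N) \/ [/\ m = 0%N, t = n, odd n, w 0 = 1%N & w n%:Z = 1%N]).
Proof.
move=> aq aw; have := alt_le w_le.
set aW := alt B (fun i => (w i)%:Z) in aw *; rewrite ler_norml => /andP[aW_ge aW_le].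
have a0 : alt B (fun i => (betti i)%:Z) = 0 by lia.
have aW0 : aW = 0 by lia.
split=> //.
pose l := [:: 0%:Z; m%:Z; n%:Z; t%:Z].
have wl i : i \notin l -> w i = 0%N.
  by move=> il; have := w_le i; rewrite /betti (count_memPn il); lia.
have [/hasP[i il wi]|/hasPn h] := boolP (has (fun i => w i != 0%N) l); last first.
  left=> i; have [/h|/wl //] := boolP (i \in l).
  by rewrite negbK => /eqP.
have nat_of i' : i' \in l -> exists2 x : nat, (x <= B)%N & i' = x%:Z.
  by rewrite !inE => /or4P[]/eqP->;
    [exists 0%N | exists m | exists n | exists t] => //; lia.
have [x xB ix] := nat_of i il.
have [/hasP[j jl /andP[ji wj]]|/hasPn h] :=
    boolP (has (fun j => (j != i) && (w j != 0%N)) l); last first.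
  have : aW = (-1) ^+ (x + B)%N * (w i)%:Z.
    rewrite ix; apply: (alt_single (f := fun i => (w i)%:Z)) => // j; rewrite -ix.
    have [/h|/wl ->//] := boolP (j \in l).
    by rewrite negb_and negbK => /orP[->//|]; rewrite negbK => /eqP->.
  by rewrite aW0 => /esym/eqP; rewrite mulf_eq0 signr_eq0 /= eqz_nat (negPf wi).
have [y yB jy] := nat_of j jl.
right; have wi2 := w_le i; have wj2 := w_le j.
have ci : (2 <= betti i)%N by move: wi wi2; case: (w i) => // k; lia.
have cj : (2 <= betti j)%N by move: wj wj2; case: (w j) => // k; lia.
move: ci cj ji; rewrite ix jy /betti /= !eqz_nat => ci cj ji.
have {ci} hx := sorted_double ci; have {cj} hy := sorted_double cj.
have [m0 tn n0 xy] : [/\ m = 0, t = n, n != 0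
    & x = 0 /\ y = n \/ x = n /\ y = 0]%N.
  by case: hx => [[? ?]|[[? ?]|[? ?]]]; case: hy => [[? ?]|[[? ?]|[? ?]]];
    split; lia.
move: a0; rewrite alt_betti => /eqP; rewrite mulf_eq0 signr_eq0 /= m0 tn.
rewrite expr0 sign_cases => /eqP sg.
have nodd : odd n by move: sg; case: odd => //; lia.
have w_le1 i' : i' = 0 \/ i' = n%:Z -> (w i' <= 1)%N.
  move=> hi; have := w_le i'; rewrite /betti /= m0 tn.
  by case: hi => ->; rewrite ?eqz_nat; lia.
have w0 := w_le1 0 (or_introl (erefl _)).
have wn := w_le1 n%:Z (or_intror (erefl _)).
move: wi wj; rewrite ix jy -!lt0n => wi wj.
split=> //; case: xy => -[xE yE]; rewrite xE yE in wi wj; by apply/eqP; rewrite eqn_leq ?w0 ?wn ?wi ?wj.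
Qed.

End Degrees.

(** * The theorem *)

Section TrivialAction.

Local Open Scope ring_scope.

Variables (gT : finGroupType) (G : {group gT}) (a b c : gT).
Hypothesis tetG : tetrahedral G a b c.

(** [<c>] acts trivially exactly when the projection onto its invariants is the
    identity. *)
Lemma trivial_opE (H : representation 'F_2 G) :
  (forall x, x \in <[c]>%g -> H x = 1%:M) <-> \rank (opE c H) = rdegree H.
Proof.
have CCC := rep_ccc tetG H; split=> [triv|rE].
  by rewrite /opE triv ?cycle_id // mulmx1 addmm2 add0r mxrank1.
have [e' ee'] : exists e', e' *m opE c H = 1%:M.
  by apply/row_fullP; rewrite -col_leq_rank rE.
have Hc : H c = 1%:M.
  by rewrite -[LHS]mul1mx -ee' -mulmxA /opE (mul_avgc CCC).
move=> x /cycleP[k ->]; elim: k => [|k IHk]; first by rewrite expg0 repr_mx1.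
by rewrite expgS repr_mxM ?groupX ?(tet_c tetG) // Hc IHk mulmx1.
Qed.

End TrivialAction.

Section FourClasses.

Local Open Scope ring_scope.

Variables (gT : finGroupType) (G : {group gT}) (a b c : gT).
Hypothesis tetG : tetrahedral G a b c.
Variables (P Q : representation 'F_2 G).
Hypotheses (fP : vfree a b P) (fQ : vfree a b Q).
Hypotheses (psiP : psi c P = 2) (psiQ : psi c Q = - 2%:Z).
Variable C : cochain_complex 'F_2 G.
Hypothesis perfC : perfect C.
Variables m n t : nat.
Hypotheses (le_mn : (m <= n)%N) (le_nt : (n <= t)%N).
Hypothesis dimH : forall i : int,
  rdegree (cohomology C i) = count_mem i [:: 0%:Z; m%:Z; n%:Z; t%:Z].

Let H i := cohomology C i.
Let betti (i : int) : nat := count_mem i [:: 0%:Z; m%:Z; n%:Z; t%:Z].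
Let w (i : int) : nat := (rdegree (H i) - \rank (opE c (H i)))./2.

Let wE i : betti i = (\rank (opE c (H i)) + 2 * w i)%N.
Proof.
rewrite /betti -dimH -/(H i); have [k e] := rank_opE_parity tetG (H i).
rewrite {1}e; congr (_ + _)%N; congr (_ * _)%N.
have arith (x y : nat) : (x = y + 2 * k -> k = (x - y)./2)%N by lia.
exact: arith e.
Qed.

Let psiH i : psi c (H i) = 2%:Z * (betti i)%:Z - 6%:Z * (w i)%:Z.
Proof.
have arith (d r k : nat) : (d = r + 2 * k)%N ->
  3%:Z * r%:Z - d%:Z = 2%:Z * d%:Z - 6%:Z * k%:Z by lia.
by rewrite -(arith _ _ _ (wE i)) /psi; congr (_ - Posz _); apply: dimH.
Qed.

Let altH B : alt B (fun i => psi c (H i))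
  = 2%:Z * alt B (fun i => (betti i)%:Z) - 6%:Z * alt B (fun i => (w i)%:Z).
Proof. by rewrite -!altZ -altB; apply: eq_alt => i; apply: psiH. Qed.

Let w_le i : (2 * w i <= betti i)%N.
Proof. by rewrite wE leq_addl. Qed.

Let freeC i : vfree a b (C i).
Proof. by case: perfC => _ projC; apply: (vfree_projective tetG). Qed.

Let betti_mod4 d B : (forall i : int, (d < `|i|)%N -> rdegree (C i) = 0%N) ->
  (d < B)%N -> exists q : int, alt B (fun i => (betti i)%:Z) = 4%:Z * q.
Proof.
move=> bC dB; exists (alt B (fun i => (\rank (opN a b (C i)))%:Z)).
rewrite -altZ -(eq_alt B (fun i => congr1 Posz (dimH i))) -(euler_rdegree bC dB).
by apply: eq_alt => i; rewrite -PoszM; apply: (congr1 Posz (freeC i)).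
Qed.

Let trivial_w : (forall i x, x \in <[c]>%g -> H i x = 1%:M) <->
  (forall i, w i = 0%N).
Proof.
split=> [triv i|w0 i].
  have := wE i; rewrite (proj1 (trivial_opE tetG (H i)) (triv i)) /betti -dimH.
  by rewrite -/(H i); lia.
apply/(trivial_opE tetG); apply: etrans (esym (dimH i)).
by have := wE i; rewrite w0 muln0 addn0.
Qed.

Lemma free_iff_odd_trivial :
  (exists D : cochain_complex 'F_2 G, finite_free D /\ homotopy_equivalent C D)
  <-> (odd m \/ odd n) /\ (forall i x, x \in <[c]>%g -> cohomology C i x = 1%:M).
Proof.
case: (perfC) => -[d bC] _; split=> [[D [[[d' bD] freeD] CD]]|[oddmn triv]].
  (* this range of degrees contains both complexes and the cohomology of [C] *)
  pose B := (d + d' + t).+1.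
  have dB : (d < B)%N by lia.
  have d'B : (d' < B)%N by lia.
  have tB : (t <= B)%N by lia.
  have [q altq] := betti_mod4 bC dB.
  have altpsi : alt B (fun i => psi c (H i)) = 0.
    rewrite (eq_alt _ (psi_cohomology_homotopy tetG CD)) -(euler_psi tetG bD d'B).
    by rewrite /alt big1 // => k _; rewrite (psi_free tetG (freeD _)) mulr0.
  have altw : 2%:Z * alt B (fun i => (betti i)%:Z) = 6%:Z * alt B (fun i => (w i)%:Z).
    by apply/eqP; rewrite -subr_eq0 -altH altpsi.
  have [alt0 [w0|[m0 tn oddn w0 wn]]] := simple_degrees le_mn le_nt tB w_le altq altw.
    split; last exact/trivial_w.
    by apply/(alt_betti_odd le_mn le_nt tB); first by exists q.
  have n0 : (0 < n)%N by case: (n) oddn.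
  have dim2 i : i = 0 \/ i = n%:Z ->
      rdegree (H i) = 2%N /\ \rank (opE c (H i)) = 0%N.
    have arith (x r k : nat) : (x <= 2 -> k = 1 -> x = r + 2 * k -> x = 2 /\ r = 0)%N.
      by lia.
    move=> hi; apply: arith (etrans (dimH i) (wE i)).
      by rewrite dimH /= m0 tn; case: hi => ->; rewrite ?eqz_nat; lia.
    by case: hi => ->.
  case: (@no_two_simples _ _ _ _ _ tetG C d n freeC bC n0) => // i i0 iN.
  by rewrite dimH /= m0 tn !(eq_sym _ i) (negPf i0) (negPf iN).
pose B := (d + t).+1.
have dB : (d < B)%N by lia.
have tB : (t <= B)%N by lia.
have bB (i : int) : (B < `|i|)%N -> rdegree (C i) = 0%N by move=> Bi; apply: bC; lia.
apply: (free_replacement tetG fP fQ psiP psiQ freeC bB).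
rewrite (euler_psi tetG bC dB) altH.
have w0 := proj1 trivial_w triv.
rewrite (proj1 (alt_betti_odd le_mn le_nt tB (betti_mod4 bC dB)) oddmn) mulr0.
by rewrite /alt big1 ?mulr0 ?subrr // => k _; rewrite w0 mulr0.
Qed.

End FourClasses.

Lemma alt4_tetrahedral (C3 : {group {perm 'I_4}}) :
    C3 \subset ('Alt_('I_4))%g -> #|C3| = 3 ->
  exists a b c : {perm 'I_4},
    [/\ tetrahedral 'Alt_('I_4)%G a b c, C3 :=: <[c]>%g
      & [/\ a ord0 != ord0, b ord0 != ord0 & (a * b)%g ord0 != ord0]].
Proof.
move=> sC3 oC3; have [a [b [c [[aA bA cA] [C3c oc] [aa bb ab] [ac bc] fix0]]]] :=
  klein_elements sC3 oC3.
have [a0 b0 ab0] := fix0.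
have neq1 (x : {perm 'I_4}) : x ord0 != ord0 -> x != 1%g.
  by apply: contraNneq => ->; rewrite perm1.
exists a, b, c; split=> //; split=> //.
- have := @card_Alt 'I_4; rewrite card_ord => /(_ isT) card2.
  by apply/eqP; rewrite -(eqn_pmul2l (isT : 0 < 2)) card2.
- by have := expg_order c; rewrite oc !expgS expg0 mulg1 mulgA.
split; [exact: neq1 | exact: neq1 | | ].
  by apply: contraNneq (neq1 _ ab0) => ->; rewrite bb.
by apply: contra_eqT oc => /negPn/eqP->; rewrite order1.
Qed.

Theorem corollary7p9
  (C3 : {group {perm 'I_4}}) (sC3A4 : C3 \subset ('Alt_('I_4))%g)
  (oC3 : #|C3| = 3)
  (C : cochain_complex 'F_2 ('Alt_('I_4))%G) (perfC : perfect C)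
  (m n t : nat) (le_mn : m <= n) (le_nt : n <= t)
  (dimH : forall i : int,
     rdegree (cohomology C i) = count_mem i [:: 0%:Z; m%:Z; n%:Z; t%:Z]%R) :
  (exists D : cochain_complex 'F_2 ('Alt_('I_4))%G,
     finite_free D /\ homotopy_equivalent C D)
  <->
  ((odd m \/ odd n) /\
   forall i : int, trivial_module (subg_repr (cohomology C i) sC3A4)).
Proof.
have [a [b [c [tetG C3c [a0 b0 ab0]]]]] := alt4_tetrahedral sC3A4 oC3.
have [fP psiP] := perm_module_vfree tetG a0 b0 ab0.
have [Q fQ psiQ] := psi_kernel tetG fP (erefl _) psiP.
apply: iff_trans (free_iff_odd_trivial tetG fP fQ psiP psiQ perfC le_mn le_nt dimH) _.
split=> -[oddmn triv]; split=> // i x.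
  by move=> C3x; apply: triv; rewrite -C3c.
move=> Cx; have C3x : x \in C3 by rewrite C3c.
exact: (triv i x C3x).
Qed.
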